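(* Let $G=(V,E)$ be a digraph, $s,t\in V$, and $x:E\to\mathbb{R}_{\ge0}$ with $x(\delta^+(v))-x(\delta^-(v))=1$ if $v=s$, $=-1$ if $v=t$, and $=0$ otherwise. Let $T\subseteq V\setminus\{s,t\}$, $z\in V\setminus(\{s,t\}\cup T)$, $\lambda\in(0,2]$, and suppose $$x(\delta(U))\ge\lambda\quad\text{for all }U\subseteq V\setminus\{s,t\}\text{ with }T\cap U\ne\emptyset. \qquad( * )$$ Then one can compute in polynomial time a list of triples $(e_i,f_i,\gamma_i)\in\delta^-(z)\times\delta^+(z)\times\mathbb{R}_{>0}$, $i=1,\dots,k$, such that splitting off all $(e_i,f_i,\gamma_i)$ maintains $( * )$ and results in $x(e)=0$ for all edges $e$ incident to $z$. Here splitting off $(e,f,\gamma)$ means reducing $x(e)$ and $x(f)$ by $\gamma$ and adding an edge of weight $\gamma$ from the tail of $e$ to the head of $f$.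
   Context: For a digraph and $U\subseteq V$, $\delta^+(U)$ ($\delta^-(U)$) is the set of edges leaving (entering) $U$, $\delta(U)=\delta^+(U)\cup\delta^-(U)$, and $x(F)=\sum_{e\in F}x(e)$; for a vertex $v$, $\delta^\pm(v)=\delta^\pm(\{v\})$. *)

(* Defs.v *)
From HB Require Import structures.
From mathcomp Require Import all_boot all_order all_algebra.

Set Implicit Arguments.
Unset Strict Implicit.
Unset Printing Implicit Defensive.

Import Order.TTheory GRing.Theory Num.Theory.
Local Open Scope ring_scope.

(* Finite weighted directed multigraphs; parallel edges and loops are allowed
   (splitting off can create both). *)
Record wdigraph (R : realFieldType) (V : finType) := WDigraph {
  edge : finType;
  tail : edge -> V;
  head : edge -> V;
  weight : edge -> R
}.

Section Digraphs.
Variables (R : realFieldType) (V : finType).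
Implicit Types (G : wdigraph R V) (U T : {set V}).

Definition delta_out G U : {set edge G} :=
  [set e | (tail e \in U) && (head e \notin U)].

Definition delta_in G U : {set edge G} :=
  [set e | (tail e \notin U) && (head e \in U)].

Definition delta G U : {set edge G} := delta_out G U :|: delta_in G U.

Definition total G (F : {set edge G}) : R := \sum_(e in F) weight e.

Definition unit_flow G (s t : V) : Prop :=
  forall v : V,
    total (delta_out G [set v]) - total (delta_in G [set v]) =
      if v == s then 1 else if v == t then -1 else 0.

Definition cut_condition G (s t : V) T (lambda : R) : Prop :=
  forall U, U \subset ~: [set s; t] -> T :&: U != set0 ->
    lambda <= total (delta G U).

(* The new edge is [None]; an old edge [a] becomes [Some a]. *)
Definition split_off G (e f : edge G) (gamma : R) : wdigraph R V :=
  @WDigraph R V (option (edge G))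
    (fun a => if a is Some b then tail b else tail e)
    (fun a => if a is Some b then head b else head f)
    (fun a => if a is Some b then
                weight b - gamma *+ (b == e) - gamma *+ (b == f)
              else gamma).

(* Splits off the triples of [l] one after the other; [emb] locates the edges
   of the original graph (of edge type [E0]) in the current one. *)
Fixpoint split_off_list (E0 : Type) (l : seq (E0 * E0 * R))
    (G : wdigraph R V) (emb : E0 -> edge G) : wdigraph R V :=
  if l is (e, f, gamma) :: l' then
    @split_off_list E0 l' (split_off (emb e) (emb f) gamma)
      (fun a => Some (emb a))
  else G.

Definition split_off_all G (l : seq (edge G * edge G * R)) : wdigraph R V :=
  split_off_list l (fun a : edge G => a).

End Digraphs.

(* Real-RAM model. A program handles finitely many two-dimensional arrays of
   natural numbers and finitely many two-dimensional arrays of reals; arrays are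
   named by constants, indices are computed. Every assignment and every test
   costs one unit: expressions of a fixed program have bounded size. There is
   deliberately no multiplication, neither of naturals nor of reals: numbers then
   grow by O(1) bits per step, so that on rational inputs a polynomial number of
   steps also means polynomial time on a Turing machine. *)
Inductive nexp : Type :=
  | NConst of nat
  | NRead of nat & nexp & nexp
  | NAdd of nexp & nexp
  | NSub of nexp & nexp.

Inductive rexp : Type :=
  | RZero
  | ROne
  | RRead of nat & nexp & nexp
  | RAdd of rexp & rexp
  | RSub of rexp & rexp
  | RHalf of rexp.

Inductive bexp : Type :=
  | BNatLe of nexp & nexp
  | BRealLe of rexp & rexp
  | BNot of bexp
  | BAnd of bexp & bexp.

Inductive cmd : Type :=
  | Skip
  | NWrite of nat & nexp & nexp & nexp
  | RWrite of nat & nexp & nexp & rexp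
  | Seq of cmd & cmd
  | If of bexp & cmd & cmd
  | While of bexp & cmd.

Definition memory (A : Type) := nat -> nat -> nat -> A.

Definition write (A : Type) (m : memory A) (a i j : nat) (v : A) : memory A :=
  fun a' i' j' => if [&& a' == a, i' == i & j' == j] then v else m a' i' j'.

Record state (R : Type) := State { nmem : memory nat; rmem : memory R }.

Section Semantics.
Variable R : realFieldType.
Implicit Type st : state R.

Fixpoint neval st (e : nexp) : nat :=
  match e with
  | NConst n => n
  | NRead a i j => nmem st a (neval st i) (neval st j)
  | NAdd e1 e2 => (neval st e1 + neval st e2)%N
  | NSub e1 e2 => (neval st e1 - neval st e2)%N
  end.

Fixpoint reval st (e : rexp) : R :=
  match e with
  | RZero => 0
  | ROne => 1
  | RRead a i j => rmem st a (neval st i) (neval st j)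
  | RAdd e1 e2 => reval st e1 + reval st e2
  | RSub e1 e2 => reval st e1 - reval st e2
  | RHalf e1 => reval st e1 / 2
  end.

Fixpoint beval st (b : bexp) : bool :=
  match b with
  | BNatLe e1 e2 => (neval st e1 <= neval st e2)%N
  | BRealLe e1 e2 => reval st e1 <= reval st e2
  | BNot b1 => ~~ beval st b1
  | BAnd b1 b2 => beval st b1 && beval st b2
  end.

(* [exec P st n st']: started in [st], [P] halts after [n] steps in [st']. *)
Inductive exec : cmd -> state R -> nat -> state R -> Prop :=
  | ExecSkip st : exec Skip st 1 st
  | ExecNWrite st a i j e :
      exec (NWrite a i j e) st 1
        (State (write (nmem st) a (neval st i) (neval st j) (neval st e))
               (rmem st))
  | ExecRWrite st a i j e :
      exec (RWrite a i j e) st 1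
        (State (nmem st)
               (write (rmem st) a (neval st i) (neval st j) (reval st e)))
  | ExecSeq P1 P2 st st1 st2 n1 n2 :
      exec P1 st n1 st1 -> exec P2 st1 n2 st2 ->
      exec (Seq P1 P2) st (n1 + n2) st2
  | ExecIfTrue b P1 P2 st st1 n :
      beval st b -> exec P1 st n st1 -> exec (If b P1 P2) st n.+1 st1
  | ExecIfFalse b P1 P2 st st1 n :
      ~~ beval st b -> exec P2 st n st1 -> exec (If b P1 P2) st n.+1 st1
  | ExecWhileFalse b P st :
      ~~ beval st b -> exec (While b P) st 1 st
  | ExecWhileTrue b P st st1 st2 n1 n2 :
      beval st b -> exec P st n1 st1 -> exec (While b P) st1 n2 st2 ->
      exec (While b P) st (n1 + n2).+1 st2.

End Semantics.

(* Vertices and edges are presented to programs by their position in [enum]. *)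
Definition code (I : finType) (a : I) : nat := enum_rank a.

Definition load (A : Type) (a0 : A) (arrays : seq (seq A)) : memory A :=
  fun a i j => if j is 0%N then nth a0 (nth [::] arrays a) i else a0.

Definition input (R : realFieldType) (V : finType) (G : wdigraph R V)
    (s t z : V) (T : {set V}) (lambda : R) : state R :=
  State
    (load 0%N [:: [:: #|V|; #|edge G|; code s; code t; code z];
                  [seq code (tail e) | e <- enum (edge G)];
                  [seq code (head e) | e <- enum (edge G)];
                  [seq nat_of_bool (v \in T) | v <- enum V]])
    (load 0 [:: [:: lambda]; [seq weight e | e <- enum (edge G)]]).

(* Output convention: nat array 4 holds the length of the list, nat arrays 5 and
   6 the codes of the edges e_i and f_i, and real array 2 the numbers gamma_i. *)
Definition outputs (R : realFieldType) (E : finType) (st : state R)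
    (l : seq (E * E * R)) : Prop :=
  [/\ nmem st 4%N 0%N 0%N = size l,
      [seq nmem st 5%N i 0%N | i <- iota 0 (size l)] = [seq code p.1.1 | p <- l],
      [seq nmem st 6%N i 0%N | i <- iota 0 (size l)] = [seq code p.1.2 | p <- l]
    & [seq rmem st 2%N i 0%N | i <- iota 0 (size l)] = [seq p.2 | p <- l]].

(* Main.v *)
From Pilot Require Import Defs.
From HB Require Import structures.
From mathcomp Require Import all_boot all_order all_algebra.
From mathcomp Require Import zify ring lra.
(* [total] and [head] would otherwise be those of [ssrbool] and [seq]. *)
Import Pilot.Defs.

(**
  Ignoring directions, splitting off (e, f, gamma) with e = (u, z), f = (z, w)
  lowers the cut of U by 2 gamma if U separates z from both u and w, and leaves
  it unchanged otherwise. Cuts never grow, so a set that has become tight stays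
  tight, and treating every pair (e, f) once, with the largest feasible gamma,
  leaves no pair that can be split off. Uncrossing tight sets then shows that no
  weight is left at z: only x(delta^-(z)) = x(delta^+(z)) is needed for this.

  The largest gamma for a pair is found by splitting off min(x(e), x(f)) and
  giving back half of the largest violation of the cut condition. For v in T the
  violation is what remains of a supply of lambda at v when as much of it as
  possible is sent to {s, t}; it is computed by push-relabel on the undirected
  graph, with all labels starting at 0 and capped at n = |V|. A round discharges
  every vertex once; each round raises a label or lowers the maximal label of an
  active vertex, hence n^4 rounds suffice. Since every loop runs over the
  vertices or the edges, the running time is polynomial.
*)

Set Implicit Arguments.
Unset Strict Implicit.
Unset Printing Implicit Defensive.

Import Order.TTheory GRing.Theory Num.Theory.
Local Open Scope ring_scope.

(** * Programs with bounded loops *)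

(* [PFor k l p] runs [p] with the counter [k[0]] ranging over the numbers below
   [0[l]], that is, over vertices ([l = 0]) or edges ([l = 1]). *)
Inductive prog : Type :=
  | PN of nat & nexp & nexp & nexp
  | PR of nat & nexp & nexp & rexp
  | PSeq of prog & prog
  | PIf of bexp & prog
  | PFor of nat & nat & prog.

Definition N0 := NConst 0.
Definition cnt k := NRead k N0 N0.

Fixpoint compile (p : prog) : cmd :=
  match p with
  | PN a i j e => NWrite a i j e
  | PR a i j e => RWrite a i j e
  | PSeq p1 p2 => Seq (compile p1) (compile p2)
  | PIf b p1 => If b (compile p1) Skip
  | PFor k l p1 =>
      Seq (NWrite k N0 N0 N0)
        (While (BNatLe (NAdd (cnt k) (NConst 1)) (NRead 0 (NConst l) N0))
           (Seq (compile p1) (NWrite k N0 N0 (NAdd (cnt k) (NConst 1)))))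
  end.

Fixpoint nwrites (p : prog) : seq nat :=
  match p with
  | PN a _ _ _ => [:: a]
  | PR _ _ _ _ => [::]
  | PSeq p1 p2 => nwrites p1 ++ nwrites p2
  | PIf _ p1 => nwrites p1
  | PFor k _ p1 => k :: nwrites p1
  end.

Fixpoint rwrites (p : prog) : seq nat :=
  match p with
  | PN _ _ _ _ => [::]
  | PR a _ _ _ => [:: a]
  | PSeq p1 p2 => rwrites p1 ++ rwrites p2
  | PIf _ p1 => rwrites p1
  | PFor _ _ p1 => rwrites p1
  end.

(** Array 0 stores |V| and |E|, which bound the loops, so it is never written, and a body leaves its
    own counter alone. Hence a loop makes exactly as many iterations as its bound says on entry. *)
Fixpoint wf (p : prog) : bool :=
  match p with
  | PN a _ _ _ => a != 0%N
  | PR _ _ _ _ => true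
  | PSeq p1 p2 => wf p1 && wf p2
  | PIf _ p1 => wf p1
  | PFor k l p1 => [&& (l < 2)%N, k != 0%N, k \notin nwrites p1 & wf p1]
  end.

(** Together with [tdeg] this gives the time bound [tcoef p * K ^ tdeg p] with [K] = |V| + |E|. The
    summands 2 and 4 pay for tests, counter updates and [Skip]. *)
Fixpoint tcoef (p : prog) : nat :=
  match p with
  | PN _ _ _ _ => 1
  | PR _ _ _ _ => 1
  | PSeq p1 p2 => tcoef p1 + tcoef p2
  | PIf _ p1 => tcoef p1 + 2
  | PFor _ _ p1 => tcoef p1 + 4
  end.

Fixpoint tdeg (p : prog) : nat :=
  match p with
  | PN _ _ _ _ => 0
  | PR _ _ _ _ => 0
  | PSeq p1 p2 => maxn (tdeg p1) (tdeg p2)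
  | PIf _ p1 => tdeg p1
  | PFor _ _ p1 => (tdeg p1).+1
  end.

Fact den_key : unit.
Proof. exact: tt. Qed.

Section Denotation.
Variable R : realFieldType.
Implicit Type st : state R.

Definition setn st a i j v := State (write (nmem st) a i j v) (rmem st).
Definition setr st a i j v := State (nmem st) (write (rmem st) a i j v).
Definition incr k st := setn st k 0 0 (nmem st k 0 0 + 1)%N.

Fixpoint den_rec (p : prog) st : state R :=
  match p with
  | PN a i j e => setn st a (neval st i) (neval st j) (neval st e)
  | PR a i j e => setr st a (neval st i) (neval st j) (reval st e)
  | PSeq p1 p2 => den_rec p2 (den_rec p1 st)
  | PIf b p1 => if beval st b then den_rec p1 st else st
  | PFor k l p1 =>
      iter (nmem st 0 l 0) (fun st1 => incr k (den_rec p1 st1))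
        (setn st k 0 0 0)
  end.

(* Locked, lest the kernel execute programs while comparing states. *)
Definition den := locked_with den_key den_rec.

Lemma den_seq p1 p2 st : den (PSeq p1 p2) st = den p2 (den p1 st).
Proof. by rewrite /den unlock. Qed.

Lemma den_if b p1 st :
  den (PIf b p1) st = if beval st b then den p1 st else st.
Proof. by rewrite /den unlock. Qed.

Lemma den_pn a i j e st :
  den (PN a i j e) st = setn st a (neval st i) (neval st j) (neval st e).
Proof. by rewrite /den unlock. Qed.

Lemma den_pr a i j e st :
  den (PR a i j e) st = setr st a (neval st i) (neval st j) (reval st e).
Proof. by rewrite /den unlock. Qed.

Lemma den_iter k l p st : den (PFor k l p) st =
  iter (nmem st 0 l 0) (fun st1 => incr k (den p st1)) (setn st k 0 0 0).
Proof. by rewrite /den unlock. Qed.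

Definition denE := (den_seq, den_if, den_pn, den_pr).

Lemma den_nframe p st a i j :
  a \notin nwrites p -> nmem (den p st) a i j = nmem st a i j.
Proof.
elim: p st => [b i0 j0 e|b i0 j0 e|p1 IH1 p2 IH2|b p1 IH1|k l p1 IH1] st; rewrite ?denE ?den_iter //=.
- by rewrite inE /write => /negPf->.
- by rewrite mem_cat negb_or => /andP[h1 h2]; rewrite IH2 // IH1.
- by move=> h; case: ifP => // _; rewrite IH1.
rewrite inE negb_or => /andP[/negPf hk h].
elim: (nmem st 0 l 0) => [|N IHN] /=; first by rewrite /write hk.
by rewrite {1}/write hk IH1.
Qed.

Lemma den_rframe p st a i j :
  a \notin rwrites p -> rmem (den p st) a i j = rmem st a i j.
Proof.
elim: p st => [b i0 j0 e|b i0 j0 e|p1 IH1 p2 IH2|b p1 IH1|k l p1 IH1] st; rewrite ?denE ?den_iter //=.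
- by rewrite inE /write => /negPf->.
- by rewrite mem_cat negb_or => /andP[h1 h2]; rewrite IH2 // IH1.
- by move=> h; case: ifP => // _; rewrite IH1.
by move=> h; elim: (nmem st 0 l 0) => [|N IHN] //=; rewrite IH1.
Qed.

Lemma wf_nwrites0 p : wf p -> 0%N \notin nwrites p.
Proof.
elim: p => [b i0 j0 e|b i0 j0 e|p1 IH1 p2 IH2|b p1 IH1|k l p1 IH1] //=.
- by rewrite inE eq_sym.
- by rewrite mem_cat negb_or => /andP[/IH1-> /IH2->].
by case/and4P=> _ hk _ /IH1 h; rewrite inE negb_or eq_sym hk h.
Qed.

(** By induction on [p]: a loop runs at most [K] times and so raises the degree by one. [K] can be
    read off the initial state because array 0 never changes. *)
Lemma exec_den p st (K := (nmem st 0 0 0 + nmem st 0 1 0)%N) :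
  wf p -> (0 < K)%N ->
  exists2 n, exec (compile p) st n (den p st) & (n <= tcoef p * K ^ tdeg p)%N.
Proof.
rewrite {}/K.
elim: p st => [a i j e|a i j e|p1 IH1 p2 IH2|b p1 IH1|k l p1 IH1] st;
  rewrite ?denE ?den_iter.
- by exists 1%N => //; constructor.
- by exists 1%N => //; constructor.
- move=> /= /andP[w1 w2] K0.
  have [n1 E1 B1] := IH1 st w1 K0.
  have h0 i : nmem (den p1 st) 0 i 0 = nmem st 0 i 0.
    by rewrite den_nframe // wf_nwrites0.
  have := IH2 (den p1 st) w2; rewrite !h0 => /(_ K0)[n2 E2 B2].
  exists (n1 + n2)%N; first by econstructor; eauto.
  rewrite mulnDl leq_add //; [apply: leq_trans B1 _|apply: leq_trans B2 _];
    by rewrite leq_mul2l leq_pexp2l ?orbT // ?leq_maxl ?leq_maxr.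
- move=> /= w1 K0; have [n1 E1 B1] := IH1 st w1 K0.
  set K := (_ + _)%N in K0 B1 *.
  have P0 : (0 < K ^ tdeg p1)%N by rewrite expn_gt0 K0.
  case: ifP => hb.
    by exists n1.+1; [apply: ExecIfTrue | nia].
  exists 2%N; last by nia.
  by apply: ExecIfFalse; rewrite ?hb //; constructor.
move=> /= /and4P[l2 k0 kp w1] K0.
set K := (_ + _)%N in K0 *; set N := nmem st 0 l 0.
set W := While _ _; set B := (tcoef p1 * K ^ tdeg p1)%N.
have NK : (N <= K)%N.
  by rewrite /N /K; case: l l2 {W N} => [|[|//]] _; rewrite ?leq_addr ?leq_addl.
(* Induction on the number [j] of remaining iterations. Each pays [B] for the body, 1 for the
   counter and 1 for the test; the last, failing test costs 1. *)
have loop j st1 : (nmem st1 k 0 0 + j = N)%N ->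
    (forall i, nmem st1 0 i 0 = nmem st 0 i 0)%N ->
    exists2 n, exec W st1 n (iter j (fun s => incr k (den p1 s)) st1)
      & (n <= j * (B + 2) + 1)%N.
  elim: j st1 => [|j IHj] st1 e1 e0.
    exists 1%N => //; apply: ExecWhileFalse => /=.
    by rewrite e0 -/N; lia.
  have := IH1 st1 w1; rewrite !e0 -/K -/B => /(_ K0)[n1 E1 B1].
  have [||n2 E2 B2] := IHj (incr k (den p1 st1)).
  - by rewrite /= /write !eqxx /= den_nframe //; lia.
  - move=> i; rewrite /= /write eq_sym (negPf k0) /=.
    by rewrite den_nframe ?wf_nwrites0.
  exists ((n1 + 1) + n2).+1; last by lia.
  rewrite iterSr; apply: ExecWhileTrue E2; first by rewrite /= e0 -/N; lia.
  by apply: ExecSeq E1 _; constructor.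
have [||n E Bn] := loop N (setn st k 0 0 0).
- by rewrite /= /write !eqxx.
- by move=> i; rewrite /= /write eq_sym (negPf k0).
exists (1 + n)%N; first by apply: ExecSeq E; constructor.
have P0 : (0 < K ^ tdeg p1)%N by rewrite expn_gt0 K0.
apply: leq_trans (_ : 1 + (K * (B + 2) + 1) <= _)%N.
  rewrite leq_add2l; apply: leq_trans Bn _.
  by rewrite leq_add2r leq_mul2r NK orbT.
rewrite expnS /B; set X := (K ^ _)%N in P0 *; set t := tcoef p1.
(* Since [K] and [X] are positive, the lower-order cost [2 * K + 2] is at most [4 * K * X]. *)
have : (K * 1 <= K * X)%N by rewrite leq_mul2l P0 orbT.
by nia.
Qed.

(** The invariant rule for loops. [Inv i] holds before iteration [i]; the rule itself supplies the
    value of the counter. *)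
Lemma den_for k l p st (Inv : nat -> state R -> Prop) (N := nmem st 0 l 0) :
  wf (PFor k l p) ->
  Inv 0%N (setn st k 0 0 0) ->
  (forall i st1, (i < N)%N -> nmem st1 k 0 0 = i -> Inv i st1 ->
     Inv i.+1 (incr k (den p st1))) ->
  Inv N (den (PFor k l p) st).
Proof.
case/and4P=> l2 k0 kp w1 H0 HS; rewrite den_iter -/N.
suff H j : (j <= N)%N -> let st1 := iter j (fun s => incr k (den p s))
    (setn st k 0 0 0) in Inv j st1 /\ nmem st1 k 0 0 = j.
  by case: (H N (leqnn N)).
elim: j => [|j IHj] jN /=; first by split=> //; rewrite /write !eqxx.
have [Ij cj] := IHj (ltnW jN); split; first exact: HS.
by rewrite {1}/write !eqxx /= den_nframe // cj addn1.
Qed.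

End Denotation.

(** * A vertex without splittable pairs is isolated *)

Definition crosses (V : finType) (U : {set V}) (a b : V) : bool :=
  (a \in U) (+) (b \in U).

Lemma crossesC (V : finType) (U : {set V}) a b : crosses (~: U) a b = crosses U a b.
Proof. by rewrite /crosses !inE; do 2 case: (_ \in U). Qed.

Section Isolation.
Variables (R : realFieldType) (V : finType) (G : wdigraph R V).
Implicit Types X Y U : {set V}.
Hypothesis w_ge0 : forall e : edge G, 0 <= weight e.

Lemma totalE (F : {set edge G}) : total F = \sum_e weight e *+ (e \in F).
Proof. by rewrite /total big_mkcond; apply: eq_bigr => e _; case: (e \in F). Qed.

Lemma mem_delta U e : (e \in delta G U) = crosses U (tail e) (head e).
Proof.
by rewrite !inE /crosses; case: (tail e \in U); case: (head e \in U).
Qed.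

Lemma total_deltaE U :
  total (delta G U) = \sum_(e : edge G) weight e *+ crosses U (tail e) (head e).
Proof. by rewrite totalE; apply: eq_bigr => e _; rewrite mem_delta. Qed.

Lemma total_deltaC U : total (delta G (~: U)) = total (delta G U).
Proof. by rewrite !total_deltaE; apply: eq_bigr => e _; rewrite crossesC. Qed.

(** The cut inequalities below are checked edge by edge, comparing how often an edge is counted on
    either side; edges of weight 0 are exempt. *)
Lemma ler_sum_edge (m1 m2 : edge G -> nat) :
  (forall e, weight e = 0 \/ (m1 e <= m2 e)%N) ->
  \sum_e weight e *+ m1 e <= \sum_e weight e *+ m2 e.
Proof.
move=> h; apply: ler_sum => e _; have [->|le12] := h e; first by rewrite !mul0rn.
exact: ler_wpMn2l.
Qed.

Lemma sum_edge1 (f : edge G) k : \sum_e weight e *+ (k * (e == f)) = weight f *+ k.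
Proof.
rewrite (bigD1 f) //= eqxx muln1 big1 ?addr0 // => e /negPf->.
by rewrite muln0.
Qed.

Lemma delta_submodular X Y :
  total (delta G (X :&: Y)) + total (delta G (X :|: Y)) <=
  total (delta G X) + total (delta G Y).
Proof.
rewrite !total_deltaE -!big_split /=.
under eq_bigr do rewrite -mulrnDr.
under [leRHS]eq_bigr do rewrite -mulrnDr.
apply: ler_sum_edge => e; right; rewrite /crosses !inE.
by do 2 case: (_ \in X); do 2 case: (_ \in Y).
Qed.

(** The edge [f] joins [X :&: Y] to the outside of [X :|: Y], so both cuts on the right count it and
    neither cut on the left does. This is the gain of twice its weight. *)
Lemma delta_posimodular X Y (f : edge G) :
  head f \in X :&: Y -> tail f \notin X :|: Y ->
  total (delta G (X :\: Y)) + total (delta G (Y :\: X)) + weight f *+ 2 <=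
  total (delta G X) + total (delta G Y).
Proof.
move=> hf tf; rewrite -sum_edge1 !total_deltaE -!big_split /=.
under eq_bigr do rewrite -!mulrnDr.
under [leRHS]eq_bigr do rewrite -mulrnDr.
apply: ler_sum_edge => e; right; rewrite /crosses; case: (eqVneq e f) => [->|_].
  by move: hf tf; rewrite !inE; do 2 case: (_ \in X); do 2 case: (_ \in Y).
by rewrite !inE; do 2 case: (_ \in X); do 2 case: (_ \in Y).
Qed.

Variables (s t z : V) (T : {set V}) (lam : R).

Definition required U := (U \subset ~: [set s; t]) && (T :&: U != set0).

(* The sets [U] or [~: U] with [U] required. *)
Definition separating U :=
  ((s \in U) == (t \in U)) && [exists v in T, (v \in U) != (s \in U)].

(** If [s] lies in [U], the complement of [U] avoids [s] and [t]. *)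
Lemma separating_required U : separating U -> required U \/ required (~: U).
Proof.
rewrite /separating /required => /andP[/eqP st /exists_inP[v vT]].
case hs: (s \in U) => vU; [right|left]; apply/andP; split.
- by rewrite setCS subUset !sub1set hs -st.
- by apply/set0Pn; exists v; rewrite !inE vT; case: (v \in U) vU.
- by rewrite subsetC subUset !sub1set !inE hs -st hs.
- by apply/set0Pn; exists v; rewrite !inE vT; case: (v \in U) vU.
Qed.

Lemma required_separating U : required U -> separating U /\ separating (~: U).
Proof.
rewrite /required subsetC subUset !sub1set !inE => /andP[/andP[sU tU]].
case/set0Pn=> v; rewrite inE => /andP[vT vU].
split; apply/andP; rewrite ?inE (negPf sU) (negPf tU); split=> //.
  by apply/exists_inP; exists v => //; rewrite vU.
by apply/exists_inP; exists v => //; rewrite inE vU.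
Qed.

Hypothesis balanced : total (delta_in G [set z]) = total (delta_out G [set z]).
Hypothesis z_notin : z \notin [set s; t] :|: T.
Hypothesis cut_ge : cut_condition G s t T lam.

Lemma separating_cut U : separating U -> lam <= total (delta G U).
Proof.
by case/separating_required=> /andP[h1 h2]; [|rewrite -total_deltaC]; apply: cut_ge.
Qed.

(** Let [X] separate [u], and [Y] separate [v], from [s]. If [s] is in neither set, then either [u]
    or [v] lies in both sets, or [u] is in [X :\: Y] and [v] in [Y :\: X]. The other positions of
    [s] reduce to this by complementing [X] or [Y]. *)
Lemma separating_uncross X Y : separating X -> separating Y ->
  separating (X :&: Y) && separating (X :|: Y) \/
  separating (X :\: Y) && separating (Y :\: X).
Proof.
case/andP=> /eqP eX /exists_inP[u uT uX] /andP[/eqP eY /exists_inP[v vT vY]].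
pose sep (Z : {set V}) :=
  ((u \in Z) != (s \in Z)) || ((v \in Z) != (s \in Z)).
have sepI (Z : {set V}) : (s \in Z) = (t \in Z) -> sep Z -> separating Z.
  move=> eZ /orP h; rewrite /separating eZ eqxx -eZ /=; apply/exists_inP.
  by case: h; [exists u|exists v].
have : sep (X :&: Y) && sep (X :|: Y) || sep (X :\: Y) && sep (Y :\: X).
  rewrite /sep !inE; move: uX vY.
  by do 3 case: (_ \in X) => //=; do 3 case: (_ \in Y) => //=.
by case/orP=> /andP[h1 h2]; [left|right]; rewrite !sepI // !inE eX eY.
Qed.

(** A tight set whose cut would fall below [lam] if an edge from [a] to [z] and an edge from [z] to
    [b] were split off. *)
Definition blocks U a b :=
  [&& required U, total (delta G U) == lam, (a \in U) == (b \in U)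
    & (z \in U) != (a \in U)].

(* Uncrossing shows that the tight sets avoiding [z] and containing the head of
   [f] are closed under union; the largest one [X] contains all tails of edges
   entering [z], so that adding [z] to [X] makes the cut smaller. *)
Lemma unsplittable_out (f : edge G) :
  (forall e f : edge G, e \in delta_in G [set z] -> f \in delta_out G [set z] ->
     0 < weight e -> 0 < weight f -> exists U, blocks U (tail e) (head f)) ->
  f \in delta_out G [set z] -> weight f = 0.
Proof.
move=> hblock fz; apply/eqP; rewrite eq_le w_ge0 andbT leNgt; apply/negP => wf0.
pose P X := [&& separating X, total (delta G X) == lam, head f \in X & z \notin X].
have tz : tail f = z by move: fz; rewrite !inE => /andP[/eqP].
(* A blocking set may contain [z]. Its complement then does not, which is why [P] speaks of
   separating sets. *)
have getP e : e \in delta_in G [set z] -> 0 < weight e ->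
    exists2 X, P X & tail e \in X.
  move=> ez we; have [U /and4P[rU /eqP tU /eqP eU zU]] := hblock e f ez fz we wf0.
  have [s1 s2] := required_separating rU.
  case hU: (tail e \in U) eU zU => eU zU; [exists U|exists (~: U)] => //.
  - by rewrite /P s1 tU eqxx -eU; case: (z \in U) zU.
  - by rewrite /P s2 total_deltaC tU !inE eqxx -eU; case: (z \in U) zU.
  - by rewrite inE hU.
(* Submodularity makes the union tight. The other way of uncrossing is impossible: there [f]
   contributes a positive gain, so one of the two differences would have a cut below [lam]. *)
have unionP X Y : P X -> P Y -> P (X :|: Y).
  case/and4P=> sX /eqP tX fX zX /and4P[sY /eqP tY fY zY].
  have [/andP[s1 s2]|/andP[s1 s2]] := separating_uncross sX sY.
    rewrite /P s2 !inE fX negb_or zX zY andbT /=.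
    have := delta_submodular X Y; have := separating_cut s1.
    have := separating_cut s2; rewrite tX tY => h1 h2 h3.
    by rewrite andbT; apply/eqP; lra.
  have /delta_posimodular : head f \in X :&: Y by rewrite inE fX.
  rewrite tz !inE negb_or zX zY tX tY => /(_ isT).
  have := separating_cut s1; have := separating_cut s2; rewrite mulr2n; lra.
(* By balance at [z], the positive weight of [f] forces positive weight on some entering edge. *)
have [e ez we] : exists2 e : edge G, e \in delta_in G [set z] & 0 < weight e.
  apply/exists_inP; apply: contraPT wf0; rewrite negb_exists_in => /forall_inP h.
  apply/negP; rewrite -leNgt; have : total (delta_in G [set z]) <= 0.
    by apply: sumr_le0 => e /h; rewrite -leNgt.
  rewrite balanced /total (bigD1 f) //=.
  have : 0 <= \sum_(i in delta_out G [set z] | i != f) weight i by apply: sumr_ge0.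
  lra.
have [X0 PX0 _] := getP e ez we.
have [X /maxsetP[PX maxX] _] := maxset_exists PX0.
have tailX e1 : e1 \in delta_in G [set z] -> weight e1 = 0 \/ tail e1 \in X.
  move=> e1z; have := w_ge0 e1; rewrite le_eqVlt => /orP[/eqP<-|we1]; first by left.
  have [Y PY tY] := getP e1 e1z we1; right.
  by rewrite -(maxX _ (unionP _ _ PX PY)) ?subsetUl // inE tY orbT.
case/and4P: PX => sX /eqP tX fX zX.
have sXz : separating (z |: X).
  have [zs [zt zT]] : s != z /\ t != z /\ z \notin T.
    by move: z_notin; rewrite !inE !negb_or -andbA ![z == _]eq_sym => /and3P[].
  move: sX; rewrite /separating !inE (negPf zs) (negPf zt) /=.
  case/andP=> -> /exists_inP[v vT vX] /=; apply/exists_inP; exists v => //.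
  have /negPf vz : v != z by apply: contraNneq zT => <-.
  by rewrite !inE vz /=.
have := separating_cut sXz; apply/negP; rewrite -ltNge.
(* Adding [z] to [X] removes the weighted entering edges from the cut and adds at most the leaving
   edges. By balance these cancel, and [f], which ends in [X], yields a strict decrease. *)
suff : total (delta G (z |: X)) + total (delta_in G [set z]) + weight f *+ 2 <=
       total (delta G X) + total (delta_out G [set z]).
  by rewrite tX balanced mulr2n; lra.
rewrite -sum_edge1 !total_deltaE !totalE -!big_split /=.
under eq_bigr do rewrite -!mulrnDr.
under [leRHS]eq_bigr do rewrite -mulrnDr.
apply: ler_sum_edge => e1.
have := tailX e1; rewrite /crosses !inE.
have [->|_] := eqVneq e1 f.
  move=> _; right; rewrite tz eqxx fX (negPf zX) /=.
  by move: fz; rewrite !inE tz eqxx => /negPf->.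
have [->|_] := eqVneq (tail e1) z; have [->|_] := eqVneq (head e1) z => /=;
  rewrite ?(negPf zX) /=;
  do ?[by move=> _; right; do 2 case: (_ \in X)].
by case=> // h; [left|right; rewrite h].
Qed.

(** All leaving edges have weight 0, so by balance the nonnegative weights of the entering edges sum
    to 0. *)
Lemma unsplittable_isolated :
  (forall e f : edge G, e \in delta_in G [set z] -> f \in delta_out G [set z] ->
     0 < weight e -> 0 < weight f -> exists U, blocks U (tail e) (head f)) ->
  forall e : edge G, e \in delta G [set z] -> weight e = 0.
Proof.
move=> h e; rewrite inE => /orP[|ez]; first exact: unsplittable_out.
have := balanced; rewrite [in RHS]/total big1; last first.
  by move=> f fz; apply: unsplittable_out h fz.
move/eqP; rewrite /total psumr_eq0 // => /allP/(_ e).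
by rewrite mem_index_enum ez => /(_ isT)/eqP.
Qed.

End Isolation.

(** * Preflows *)

Section Preflow.
Variables (R : realFieldType) (V : finType).
Implicit Types (c res : V -> V -> R) (ex : V -> R) (lab : V -> nat) (U : {set V}).

Definition cutw c U : R := \sum_(a in U) \sum_(b in ~: U) c a b.

Variables (s t v : V) (lam : R).

Definition nsink a := (a != s) && (a != t).

(* Supply [lam] at [v]; [res a b - c a b] is the net flow from [b] to [a]. *)
Definition preflow c res ex : Prop :=
  [/\ forall a b, 0 <= res a b,
      forall a, 0 <= ex a,
      forall a b, res a b + res b a = c a b + c b a
    & forall a, ex a = lam *+ (a == v) + \sum_b (res a b - c a b)].

(** The valid labellings of push-relabel, with [s] and [t] both acting as sinks at height 0. *)
Definition valid res lab : Prop :=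
  (forall a b, 0 < res a b -> (lab a <= (lab b).+1)%N) /\
  (forall a, ~~ nsink a -> lab a = 0%N).

Lemma preflow_push c res ex res' ex' a b x :
  preflow c res ex -> a != b -> 0 <= x -> x <= ex a -> x <= res a b ->
  (forall i j, res' i j = res i j - x *+ ((i == a) && (j == b))
                                  + x *+ ((i == b) && (j == a))) ->
  (forall i, ex' i = ex i - x *+ (i == a) + x *+ (i == b)) ->
  preflow c res' ex'.
Proof.
move=> [r0 e0 rC eE] ab x0 xa xr Er Ee; split.
- move=> i j; rewrite Er; have := r0 i j.
  have [->|_] := eqVneq i a; have [->|_] := eqVneq j b;
    rewrite ?eqxx ?(negPf ab) ?mulr1n ?mulr0n ?subr0 ?addr0 //=; try lra;
    by case: (_ && _); rewrite ?mulr1n ?mulr0n; lra.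
- move=> i; rewrite Ee; have := e0 i.
  have [->|_] := eqVneq i a; rewrite ?(negPf ab) ?mulr1n ?mulr0n; first lra.
  by case: (_ == _); rewrite ?mulr1n ?mulr0n; lra.
- move=> i j; rewrite !Er -(rC i j) ![(j == _) && _]andbC; lra.
move=> i; rewrite Ee eE.
under [in RHS]eq_bigr do rewrite Er.
have D k l : \sum_j x *+ ((i == k) && (j == l)) = x *+ (i == k).
  rewrite (bigD1 l) //= eqxx andbT big1 ?addr0 // => j /negPf->.
  by rewrite andbF.
have -> : \sum_j (res i j - x *+ ((i == a) && (j == b))
     + x *+ ((i == b) && (j == a)) - c i j) =
   \sum_j (res i j - c i j) - \sum_j x *+ ((i == a) && (j == b))
     + \sum_j x *+ ((i == b) && (j == a)).
  rewrite -sumrB -big_split /=; apply: eq_bigr => j _; lra.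
rewrite !D; lra.
Qed.

(** Conservation summed over [U]. The flow between two vertices of [U] cancels by antisymmetry,
    which is [S = - S] below. *)
Lemma preflow_cut c res ex U : preflow c res ex ->
  \sum_(a in U) ex a = lam *+ (v \in U) + cutw res U - cutw c U.
Proof.
case=> _ _ rC eE; under eq_bigr do rewrite eE.
rewrite big_split /= -addrA; congr (_ + _).
  case vU: (v \in U).
    by rewrite (bigD1 v) //= eqxx big1 ?addr0 // => i /andP[_ /negPf->].
  by rewrite big1 // => i iU; case: eqP => // iv; rewrite -iv iU in vU.
pose S := \sum_(a in U) \sum_(b in U) (res a b - c a b).
have S0 : S = 0.
  have : S = - S.
    rewrite {1}/S exchange_big /= /S -sumrN; apply: eq_bigr => a _.
    rewrite -sumrN; apply: eq_bigr => b _; have := rC a b; lra.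
  lra.
apply: (@etrans _ _ (S + (cutw res U - cutw c U))); last by rewrite S0 add0r.
rewrite /S /cutw -sumrB -big_split /=.
apply: eq_bigr => a _; rewrite (bigID (mem U)) /= -sumrB; congr (_ + _).
by apply: eq_bigl => b; rewrite inE.
Qed.

Lemma cutw_ge0 c U : (forall a b, 0 <= c a b) -> 0 <= cutw c U.
Proof. by move=> c0; do 2 apply: sumr_ge0 => ? _. Qed.

(** Pigeonhole: [a] has a label outside 0, ..., |V| - 1, and the other |V| - 1 vertices cannot take
    all of these values. The missed value is not 0, the label of [s]. *)
Lemma label_gap lab a : lab s = 0%N -> (#|V| <= lab a)%N ->
  exists2 k, (0 < k < #|V|)%N & forall b, lab b != k.
Proof.
move=> s0 an.
suff [k kn hk] : exists2 k, (k < #|V|)%N & forall b, lab b != k.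
  by exists k => //; rewrite kn andbT lt0n; apply: contraNneq (hk s) => ->; rewrite s0.
have [/exists_inP[k _ /forallP hk]|] :=
  boolP [exists k : 'I_#|V| in predT, [forall b, lab b != k]].
  by exists k.
rewrite negb_exists_in => /forall_inP h.
have : {subset iota 0 #|V| <= [seq lab b | b <- enum (predC1 a)]}.
  move=> k; rewrite mem_iota /= add0n => kn.
  have := h (Ordinal kn) isT; rewrite negb_forall => /existsP[b /negbNE/eqP bk].
  apply/mapP; exists b => //; rewrite mem_enum !inE; apply/eqP => ba.
  by move: an; rewrite -ba bk leqNgt /= kn.
move/(uniq_leq_size (iota_uniq _ _)); rewrite size_iota size_map -cardE.
have V0 : (0 < #|V|)%N by apply/card_gt0P; exists a.
by rewrite cardC1; case: #|V| V0 => // m _; rewrite ltnn.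
Qed.

(** The part of the supply that has not reached [s] or [t]. *)
Definition deficit ex : R := \sum_(a | nsink a) ex a.

(** Weak duality: at most [cutw c U] of the supply can leave [U], and the rest is excess stuck
    inside. *)
Lemma deficit_ge c res ex U : preflow c res ex ->
  v \in U -> s \notin U -> t \notin U -> lam - cutw c U <= deficit ex.
Proof.
move=> pf vU sU tU; apply: (@le_trans _ _ (\sum_(a in U) ex a)).
  rewrite (preflow_cut _ pf) vU mulr1n; have [r0 _ _ _] := pf.
  have := cutw_ge0 U r0; lra.
rewrite /deficit [leRHS](bigID (mem U)) /=.
have [_ e0 _ _] := pf.
have E : \sum_(a in U) ex a = \sum_(a | nsink a && (a \in U)) ex a.
  apply: eq_bigl => a; case aU: (a \in U); rewrite ?andbF // andbT.
  by rewrite /nsink; apply/esym/andP; split;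
    [apply: contraNneq sU|apply: contraNneq tU] => <-.
by rewrite E lerDl; apply: sumr_ge0.
Qed.

(* The vertices above a gap in the labels form a minimum cut. *)
Lemma deficit_attained c res ex lab :
  (forall a b, 0 <= c a b) -> preflow c res ex -> valid res lab ->
  (forall a, nsink a -> 0 < ex a -> (#|V| <= lab a)%N) ->
  deficit ex = 0 \/
  exists U, [/\ v \in U, s \notin U, t \notin U & deficit ex = lam - cutw c U].
Proof.
move=> c0 pf [rl s0] act; have [r0 e0 _ _] := pf.
have [s_0 t_0] : lab s = 0%N /\ lab t = 0%N.
  by rewrite !s0 // /nsink eqxx ?andbF.
have [/exists_inP[a na ea]|] := boolP [exists a in nsink, 0 < ex a]; last first.
  rewrite negb_exists_in => /forall_inP h; left.
  by apply: big1 => a /h; rewrite -leNgt => h1; apply/le_anti; rewrite h1 e0.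
have [k /andP[k0 kn] hk] := label_gap s_0 (act a na ea).
pose U := [set b | (k < lab b)%N].
have sU : s \notin U by rewrite inE s_0.
have tU : t \notin U by rewrite inE t_0.
(* No vertex has label [k], so a residual arc leaving [U] would descend by at least two labels. *)
have resU : cutw res U = 0.
  apply: big1 => i; rewrite inE => ki; apply: big1 => j; rewrite !inE -leqNgt => kj.
  apply/eqP; rewrite eq_le r0 andbT leNgt; apply/negP => /rl.
  by have := hk j; lia.
(* A vertex with stranded excess has a label of at least |V|, hence above the gap. *)
have defU : deficit ex = \sum_(b in U) ex b.
  rewrite /deficit (bigID (mem U)) /= [X in _ + X]big1 ?addr0.
    apply: eq_bigl => b; case bU: (b \in U); rewrite ?andbF // andbT.
    by rewrite /nsink; apply/andP; split;
      [apply: contraNneq sU|apply: contraNneq tU] => <-.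
  move=> b /andP[nb bU]; apply/le_anti; rewrite e0 andbT leNgt.
  by apply: contra bU => /(act b nb); rewrite inE; lia.
have := preflow_cut U pf; rewrite -defU resU addr0 => E.
(* Without [v] in [U] the formula makes the deficit nonpositive, hence 0. *)
case vU: (v \in U) E; last first.
  rewrite mulr0n => E; left; apply/le_anti; apply/andP; split.
    by rewrite E; have := cutw_ge0 U c0; lra.
  by apply: sumr_ge0.
by rewrite mulr1n => E; right; exists U.
Qed.

End Preflow.

(** * The program *)

Notation "p ;; q" := (PSeq p q) (at level 60, right associativity).

Definition rd k i := NRead k i N0.
Definition rr k i := RRead k i N0.
Definition scal k := RRead k N0 N0.
Definition set_scal k e := PR k N0 N0 e.
Definition BEq x y := BAnd (BNatLe x y) (BNatLe y x).
Definition BLt x y := BNot (BRealLe y x).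
Definition vS := rd 0 (NConst 2).
Definition vT := rd 0 (NConst 3).
Definition vZ := rd 0 (NConst 4).

(* Nat arrays: 7 labels; 8 to 16 loop counters, among them 8, 9 for the edges
   [e], [f], 10 for the source of the flow and 15, 16 for vertices.
   Real arrays: 1 current weights; 3 undirected capacities; 4 residual
   capacities; 5 excesses; scalars: 6 amount to split off, 7 [gamma], 8 largest
   deficit, 9 deficit, 10 amount to push. *)

Definition push_prog :=
  set_scal 10 (rr 5 (cnt 15)) ;;
  PIf (BRealLe (RRead 4 (cnt 15) (cnt 16)) (scal 10))
    (set_scal 10 (RRead 4 (cnt 15) (cnt 16))) ;;
  PR 4 (cnt 15) (cnt 16) (RSub (RRead 4 (cnt 15) (cnt 16)) (scal 10)) ;;
  PR 4 (cnt 16) (cnt 15) (RAdd (RRead 4 (cnt 16) (cnt 15)) (scal 10)) ;;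
  PR 5 (cnt 15) N0 (RSub (rr 5 (cnt 15)) (scal 10)) ;;
  PR 5 (cnt 16) N0 (RAdd (rr 5 (cnt 16)) (scal 10)).

Definition push_all_prog :=
  PFor 16 0
    (PIf (BEq (rd 7 (cnt 15)) (NAdd (rd 7 (cnt 16)) (NConst 1))) push_prog).

Definition relabel_prog :=
  PIf (BLt RZero (rr 5 (cnt 15)))
    (PN 7 (cnt 15) N0 (NAdd (rd 7 (cnt 15)) (NConst 1))).

Definition is_nsink := BAnd (BNot (BEq (cnt 15) vS)) (BNot (BEq (cnt 15) vT)).

(** A vertex whose label has reached |V| is no longer discharged; its excess is given up. *)
Definition pass_prog :=
  PFor 15 0
    (PIf (BAnd is_nsink (BNot (BNatLe (cnt 0) (rd 7 (cnt 15)))))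
       (push_all_prog ;; relabel_prog)).

Definition passes_prog :=
  PFor 11 0 (PFor 12 0 (PFor 13 0 (PFor 14 0 pass_prog))).

Definition init_prog :=
  PFor 15 0
    (PN 7 (cnt 15) N0 N0 ;; PR 5 (cnt 15) N0 RZero ;;
     PFor 16 0 (PR 4 (cnt 15) (cnt 16) (RRead 3 (cnt 15) (cnt 16)))) ;;
  PR 5 (cnt 10) N0 (rr 0 N0).

Definition sum_prog :=
  set_scal 9 RZero ;;
  PFor 15 0 (PIf is_nsink (set_scal 9 (RAdd (scal 9) (rr 5 (cnt 15))))).

Definition flow_prog := init_prog ;; passes_prog ;; sum_prog.

Definition deficit_prog :=
  set_scal 8 RZero ;;
  PFor 10 0
    (PIf (BNatLe (NConst 1) (rd 3 (cnt 10)))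
       (flow_prog ;; PIf (BLt (scal 8) (scal 9)) (set_scal 8 (scal 9)))).

Definition add_edge_prog u w r :=
  PR 3 u w (RAdd (RRead 3 u w) r) ;; PR 3 w u (RAdd (RRead 3 w u) r).

(** Acts on the undirected capacities only. A negative amount in scalar 6 takes back part of an
    earlier splitting. *)
Definition split_prog :=
  add_edge_prog (rd 1 (cnt 8)) vZ (RSub RZero (scal 6)) ;;
  add_edge_prog vZ (rd 2 (cnt 9)) (RSub RZero (scal 6)) ;;
  add_edge_prog (rd 1 (cnt 8)) (rd 2 (cnt 9)) (scal 6).

Definition output_prog :=
  PN 5 (cnt 4) N0 (cnt 8) ;; PN 6 (cnt 4) N0 (cnt 9) ;;
  PR 2 (cnt 4) N0 (scal 7) ;; PN 4 N0 N0 (NAdd (cnt 4) (NConst 1)).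

Definition pair_prog :=
  set_scal 7 (rr 1 (cnt 8)) ;;
  PIf (BRealLe (rr 1 (cnt 9)) (scal 7)) (set_scal 7 (rr 1 (cnt 9))) ;;
  set_scal 6 (scal 7) ;; split_prog ;; deficit_prog ;;
  set_scal 6 (RSub RZero (RHalf (scal 8))) ;; split_prog ;;
  set_scal 7 (RSub (scal 7) (RHalf (scal 8))) ;;
  PR 1 (cnt 8) N0 (RSub (rr 1 (cnt 8)) (scal 7)) ;;
  PR 1 (cnt 9) N0 (RSub (rr 1 (cnt 9)) (scal 7)) ;;
  PIf (BLt RZero (scal 7)) output_prog.

(** Loops at [z] are skipped. Edges created by splitting then never touch [z], so running over the
    original edges covers all pairs. *)
Definition main_prog :=
  PFor 8 1 (add_edge_prog (rd 1 (cnt 8)) (rd 2 (cnt 8)) (rr 1 (cnt 8))) ;;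
  PFor 8 1
    (PIf (BAnd (BEq (rd 2 (cnt 8)) vZ) (BNot (BEq (rd 1 (cnt 8)) vZ)))
       (PFor 9 1
          (PIf (BAnd (BEq (rd 1 (cnt 9)) vZ) (BNot (BEq (rd 2 (cnt 9)) vZ)))
             pair_prog))).

(** * Correctness of the flow computation *)

Lemma code_eq (I : finType) (a b : I) : (code a == code b) = (a == b).
Proof. by rewrite /code (inj_eq val_inj) (inj_eq enum_rank_inj). Qed.

Lemma code_lt (I : finType) (a : I) : (code a < #|I|)%N.
Proof. exact: ltn_ord. Qed.

Lemma codeP (I : finType) i : (i < #|I|)%N -> exists a : I, code a = i.
Proof.
by move=> h; exists (enum_val (Ordinal h)); rewrite /code enum_valK.
Qed.

Section Flow.
Variables (R : realFieldType) (V : finType) (s t v : V) (lam : R) (c : V -> V -> R).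
Implicit Type st : state R.
Local Notation n := #|V|.

Definition res st (a b : V) := rmem st 4 (code a) (code b).
Definition ex st (a : V) := rmem st 5 (code a) 0%N.
Definition lab st (a : V) := nmem st 7 (code a) 0%N.

Arguments res : simpl never.
Arguments ex : simpl never.
Arguments lab : simpl never.

Definition ctx st :=
  [/\ nmem st 0 0 0 = n, nmem st 0 2 0 = code s & nmem st 0 3 0 = code t]%N.

Lemma ctx_den p st : wf p -> ctx st -> ctx (den p st).
Proof. by move=> /wf_nwrites0 h; rewrite /ctx !den_nframe. Qed.

Lemma push_progP st a b (x := Num.min (ex st a) (res st a b))
    (st' := den push_prog st) :
  nmem st 15 0 0 = code a -> nmem st 16 0 0 = code b -> a != b ->
  (forall i j, res st' i j = res st i j - x *+ ((i == a) && (j == b))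
                                  + x *+ ((i == b) && (j == a))) /\
  (forall i, ex st' i = ex st i - x *+ (i == a) + x *+ (i == b)).
Proof.
rewrite {}/st' /push_prog => e15 e16 ab.
rewrite den_seq; set st1 := den _ st.
rewrite den_seq; set st2 := den _ st1.
have [E2 [E4 [E5 E6]]] : nmem st2 = nmem st /\ (rmem st2 4%N = rmem st 4%N /\
    (rmem st2 5%N = rmem st 5%N /\ rmem st2 10%N 0%N 0%N = x)).
  rewrite /st2 den_if /x; case: ifP; rewrite /st1 !denE /= /write /= e15 ?e16 /= => h; do !split;
    by rewrite /ex /res; case: leP h.
move: (st2) E2 E4 E5 E6 => {st1 st2} [nm rm] /= E2 E4 E5 E6.
rewrite !denE /= !E2 e15 e16; split=> [i j|i];
  rewrite /res /ex /= /write /= !code_eq E6 ?E4 ?E5 ?eqxx ?andbT;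
  rewrite [b == a]eq_sym (negPf ab) /=.
  have [->|ib] := eqVneq i b; have [->|ja] := eqVneq j a;
    rewrite ?eqxx ?[b == a]eq_sym ?(negPf ab) ?andbF /= ?mulr0n ?mulr1n ?subr0 ?addr0 //.
  by case: (boolP (_ && _)) => [/andP[/eqP-> /eqP->]|_]; rewrite ?mulr0n ?mulr1n ?subr0.
have [->|ib] := eqVneq i b.
  by rewrite eq_sym (negPf ab) mulr0n subr0.
by have [->|_] := eqVneq i a; rewrite ?mulr0n ?mulr1n ?subr0 ?addr0.
Qed.

Definition flow_inv st :=
  preflow v lam c (res st) (ex st) /\ valid s t (res st) (lab st).

(** New excess arises only one label below [a]. The last clause makes the later relabelling valid:
    if excess remains at [a], every residual arc descending by one label is saturated. *)
Lemma push_all_progP st a (st' := den push_all_prog st) :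
  ctx st -> nmem st 15 0 0 = code a -> flow_inv st ->
  [/\ flow_inv st',
      forall i, i != a -> 0 < ex st' i ->
        0 < ex st i \/ 0 < ex st a /\ lab st a = (lab st i).+1,
      ex st' a <= ex st a
    & forall b, lab st a = (lab st b).+1 -> ex st' a = 0 \/ res st' a b = 0].
Proof.
move=> cx e15 fl; have [n0 _ _] := cx.
pose Inv i st1 := [/\ (nmem st1 15 0 0 = code a) /\
      (forall j, nmem st1 7 j 0 = nmem st 7 j 0),
    flow_inv st1,
    forall i, i != a -> 0 < ex st1 i ->
        0 < ex st i \/ 0 < ex st a /\ lab st a = (lab st i).+1,
    ex st1 a <= ex st a
  & forall b, (code b < i)%N -> lab st a = (lab st b).+1 ->
      ex st1 a = 0 \/ res st1 a b = 0].
suff: Inv n st'.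
  by case=> _ h1 h2 h3 h4; split=> // b; apply: h4; apply: code_lt.
rewrite -n0; apply: den_for => //.
  by split=> // i _ h; left.
rewrite n0 => i st1 /codeP[b <-] e16 [[f15 f7] fl1 act exa sat].
have labE k : lab st1 k = lab st k by apply: f7.
rewrite den_if /= f15 e16 f7 f7 addn1 -eqn_leq -!/(lab st _); case: ifP; last first.
  move=> nt; split=> // k; rewrite ltnS leq_eqVlt code_eq => /orP[/eqP->|]; last exact: sat.
  by move/eqP; rewrite nt.
move=> /eqP tight.
have ab : a != b by apply/eqP => ab; move: tight; rewrite ab; lia.
have := push_progP f15 e16 ab; set x := Num.min _ _; set st2 := den push_prog st1.
case=> Er Ee.
have [[r0 e0 _ _] [va vs]] := fl1.
have x0 : 0 <= x by rewrite le_min e0 r0.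
have xe : x <= ex st1 a by rewrite ge_min lexx.
have xr : x <= res st1 a b by rewrite ge_min lexx orbT.
have F7 j : nmem st2 7 j 0 = nmem st 7 j 0 by rewrite den_nframe.
have F15 : nmem st2 15 0 0 = code a by rewrite den_nframe.
have exa2 : ex st2 a = ex st1 a - x by rewrite Ee eqxx (negPf ab) addr0.
have resk k : res st2 a k = res st1 a k - x *+ (k == b).
  by rewrite Er eqxx (negPf ab) addr0.
split=> //.
- split; first exact: (preflow_push (proj1 fl1) ab x0 xe xr Er Ee).
  split=> [k l|k nk]; rewrite /lab /= /write /= !F7 -!/(lab st _); last first.
    by rewrite -labE vs.
  rewrite /res /= -/(res st2 k l) Er -!labE => rkl.
  (* The only residual arc that a push can create is the reverse one, and it ascends by one
     label. *)
  case: (boolP ((k == b) && (l == a))) => [/andP[/eqP-> /eqP->]|nba].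
    by rewrite !labE tight; lia.
  apply: va; move: rkl; rewrite (negPf nba) addr0.
  by case: (_ && _); rewrite ?mulr1n ?mulr0n; lra.
- move=> k ka; rewrite /ex /= -/(ex st2 k) Ee (negPf ka) subr0.
  have [->|_] := eqVneq k b; last by rewrite addr0; apply: act.
  rewrite mulr1n => h; have [|x_0] := ltP 0 x; last by apply: act; [rewrite eq_sym|lra].
  by move=> xp; right; split=> //; exact: lt_le_trans xp (le_trans xe exa).
- by rewrite /ex /= -/(ex st2 a) exa2; apply: le_trans exa; rewrite gerBl.
move=> k; rewrite ltnS leq_eqVlt code_eq /ex /res /= -/(ex st2 a) -/(res st2 a k).
rewrite exa2 resk; case/orP=> [/eqP-> _|kb tk].
  by rewrite eqxx mulr1n /x; case: leP => _; [left|right]; rewrite subrr.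
(* An exhausted excess stays 0, since pushes are then empty; a saturated arc stays saturated, since
   later pushes use other arcs out of [a]. *)
have [eq0|eq0] := sat _ kb tk; [left|right]; first by rewrite eq0 in xe *; lra.
by case: eqP kb => [->|_ _]; [rewrite ltnn|rewrite subr0].
Qed.

(** * The potential argument bounding the number of rounds *)

Definition bounded st := forall a, (lab st a <= n)%N.
Definition sumlab st := (\sum_a lab st a)%N.
(** [k] strictly bounds the labels of the active vertices, those of label |V| having been given up;
    [k = 0] means that none is left. *)
Definition active_below k st :=
  forall i, nsink s t i -> 0 < ex st i -> (lab st i < n)%N -> (lab st i < k)%N.

(** Either excess survives the pushes and the label of [a] rises by one, or [a] is drained and all
    labels stay. *)
Lemma discharge_progP st a (st' := den (push_all_prog ;; relabel_prog) st) :
  ctx st -> nmem st 15 0 0 = code a -> flow_inv st -> nsink s t a ->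
  flow_inv st' /\
  ([/\ 0 < ex st a, forall i, i != a -> lab st' i = lab st i
     & lab st' a = (lab st a).+1] \/
   [/\ forall i, lab st' i = lab st i,
       forall i, i != a -> 0 < ex st' i ->
         0 < ex st i \/ 0 < ex st a /\ lab st a = (lab st i).+1
     & ex st' a <= 0]).
Proof.
move=> cx e15 fl na; have [] := push_all_progP cx e15 fl.
rewrite {}/st' den_seq; set st1 := den push_all_prog st => fl1 act exa sat.
have f15 : nmem st1 15 0 0 = code a by rewrite den_nframe.
have labE k : lab st1 k = lab st k by apply: den_nframe.
rewrite /relabel_prog den_if /= f15 -/(ex st1 a); case: (leP (ex st1 a) 0) => exp /=.
  by split=> //; right.
rewrite den_pn /= f15 -/(lab st1 a).
have lab2 i : lab (setn st1 7 (code a) 0 (lab st1 a + 1)) i =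
    (lab st i + (i == a))%N.
  rewrite /lab /= /write /= code_eq andbT -!/(lab _ _) !labE.
  by case: eqP => [->|_]; rewrite ?addn0.
split; last first.
  left; split=> [|i /negPf ia|]; first exact: lt_le_trans exp exa.
    by rewrite lab2 ia addn0.
  by rewrite lab2 eqxx addn1.
case: fl1 => pf1 [va vs]; split=> //; split=> [i j rij|i ni].
  rewrite !lab2; have := va i j rij; rewrite !labE.
  have [ia|_] := eqVneq i a; last by lia.
  rewrite ia in rij *; move=> le1; suff : lab st a != (lab st j).+1 by lia.
  apply/eqP => /sat[h|h]; first by move: exp; rewrite h ltxx.
  by move: rij; rewrite -[res _ a j]/(res st1 a j) h ltxx.
rewrite lab2 -labE vs //; have [ia|//] := eqVneq i a.
by rewrite ia na in ni.
Qed.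

(** Suppose no label rises. Each discharged vertex is drained, and only a vertex one label higher
    can reactivate it; that label being below [k], the reactivated one is below [k.-1]. A relabelled
    vertex was active, which gives [0 < k]. *)
Lemma pass_progP k st (st' := den pass_prog st) :
  ctx st -> flow_inv st -> bounded st -> active_below k st ->
  [/\ flow_inv st', bounded st'
    & (0 < k)%N /\ (sumlab st < sumlab st')%N \/
      sumlab st' = sumlab st /\ active_below k.-1 st'].
Proof.
move=> cx fl bd act; have [n0 _ _] := cx.
pose Inv i st1 := [/\ ctx st1, flow_inv st1, bounded st1
    & (0 < k)%N /\ (sumlab st < sumlab st1)%N \/
      sumlab st1 = sumlab st /\
      forall j, nsink s t j -> 0 < ex st1 j -> (lab st1 j < n)%N ->
        (lab st1 j < k)%N /\ ((code j < i)%N -> (lab st1 j < k.-1)%N)].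
suff: Inv n st'.
  case=> _ h1 h2 h3; split=> //; case: h3 => [|[h3 h4]]; [by left|right; split=> //].
  by move=> j nj ej lj; apply: (h4 j nj ej lj).2; apply: code_lt.
rewrite -n0; apply: den_for => //.
  by split=> //; right; split=> // j nj ej lj; split=> //; apply: act.
rewrite n0 => i st1 /codeP[a <-] e15 [cx1 fl1 bd1 dis].
have [m0 m2 m3] := cx1.
rewrite den_if /= e15 m2 m3 m0 -!eqn_leq !code_eq -/(nsink s t a) -ltnNge -/(lab st1 a).
case: ifP => [/andP[na la]|nact]; last first.
  split=> //; case: dis => [|[h1 h2]]; [by left|right; split=> // j nj ej lj].
  split; first exact: (h2 j nj ej lj).1.
  rewrite ltnS leq_eqVlt code_eq => /orP[/eqP ja|]; last exact: (h2 j nj ej lj).2.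
  by rewrite -ja nj lj in nact.
have [] := discharge_progP cx1 e15 fl1 na.
set st2 := den _ st1 => fl2 dis2.
have cx2 : ctx st2 by apply: ctx_den.
split=> //.
  move=> j; case: dis2 => [[_ h1 h2]|[h _ _]]; last by rewrite -[lab _ j]/(lab st2 j) h.
  rewrite -[lab _ j]/(lab st2 j); have [->|ja] := eqVneq j a; first by rewrite h2.
  by rewrite h1.
rewrite -[sumlab (incr _ _)]/(sumlab st2).
case: dis2 => [[ea h1 h2]|[h1 h2 h3]].
  have lt12 : (sumlab st1 < sumlab st2)%N.
    rewrite /sumlab (bigD1 a) //= [in ltnRHS](bigD1 a) //= h2.
    rewrite addSn ltnS leq_add2l; apply: eq_leq; apply: eq_bigr => j ja.
    by rewrite h1.
  left; case: dis => [[k0 h]|[<- h]]; first by split=> //; apply: ltn_trans lt12.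
  by split=> //; have [h4 _] := h a na ea la; apply: leq_ltn_trans h4.
have E12 : sumlab st2 = sumlab st1 by apply: eq_bigr.
rewrite E12; case: dis => [|[h4 h5]]; [by left|right; split=> // j nj].
rewrite -[lab _ j]/(lab st2 j) -[ex _ j]/(ex st2 j) h1 => ej lj.
have [ja|ja] := eqVneq j a; first by move: ej; rewrite ja ltNge h3.
have -> : (code j < (code a).+1)%N = (code j < code a)%N.
  by rewrite ltnS leq_eqVlt code_eq (negPf ja).
have [ej1|[ea laj]] := h2 j ja ej; first exact: h5.
by have [h6 _] := h5 a na ea la; split; [|move=> _]; lia.
Qed.

(** [N] counts the rounds. The potential combines the label sum with [n - k]; the factor [n.+1]
    outweighs the loss when a relabelling lets [k] return to [n]. *)
Definition progress N st :=
  [/\ ctx st, flow_inv st, bounded st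
    & exists k, [/\ (k <= n)%N, active_below k st
        & k = 0%N \/ (N <= n.+1 * sumlab st + (n - k))%N]].

Lemma pass_progress N st : progress N st -> progress N.+1 (den pass_prog st).
Proof.
case=> cx fl bd [k [kn act pot]].
have [fl' bd' dis] := pass_progP cx fl bd act.
split=> //; first exact: ctx_den.
case: dis => [[k0 lt]|[eq act']].
  (* After a relabelling, [n] is the trivial bound on active labels. *)
  exists n; split=> //; right; case: pot => [|pot]; first by lia.
  rewrite subnn addn0; apply: leq_trans (_ : n.+1 * (sumlab st).+1 <= _)%N.
    by rewrite mulnS; lia.
  by rewrite leq_mul2l lt orbT.
exists k.-1; split=> //; first by lia.
by case: pot => [->|pot]; [left|rewrite eq; case: k kn pot {act act'} => [|k]; [left|right; lia]].
Qed.

(** Nesting multiplies the number of rounds. The counter must avoid the input array 0 and the label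
    array 7, since it is reset. *)
Lemma for_progress p m k : k \notin [:: 0; 7]%N -> k \notin nwrites p -> wf p ->
  (forall N st, progress N st -> progress (N + m) (den p st)) ->
  forall N st, progress N st -> progress (N + n * m) (den (PFor k 0 p) st).
Proof.
rewrite !inE negb_or => /andP[k0 k7] kp wp IH N st pr.
have setP M st1 x : progress M st1 -> progress M (setn st1 k 0 0 x).
  have labE a : lab (setn st1 k 0 0 x) a = lab st1 a.
    by rewrite /lab /= /write eq_sym (negPf k7).
  have sumE : sumlab (setn st1 k 0 0 x) = sumlab st1 by apply: eq_bigr.
  case=> cx [pf [va vs]] bd [l [ln act pot]]; split.
  - by case: cx => ? ? ?; split; rewrite /= /write eq_sym (negPf k0).
  - by split=> //; split=> [a b|a na]; rewrite !labE; [apply: va|apply: vs].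
  - by move=> a; rewrite labE.
  exists l; rewrite sumE; split=> // a; rewrite labE; exact: act.
have [[n0 _ _] _ _ _] := pr; rewrite -n0.
apply: (@den_for _ k 0 p st (fun i => progress (N + i * m))) => //.
- by rewrite /= k0 kp wp.
- by rewrite mul0n addn0; apply: setP.
by move=> i st1 _ _ pr1; apply: setP; rewrite mulSn [(m + _)%N]addnC addnA; apply: IH.
Qed.

Lemma passes_progP st (st' := den passes_prog st) : (1 < n)%N -> progress 0 st ->
  [/\ ctx st', flow_inv st'
    & forall a, nsink s t a -> 0 < ex st' a -> (n <= lab st' a)%N].
Proof.
move=> n1 pr.
have : progress (0 + n * (n * (n * (n * 1)))) st'.
  have p1 N st1 : progress N st1 -> progress (N + 1) (den pass_prog st1).
    by rewrite addn1; apply: pass_progress.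
  have p2 := @for_progress pass_prog _ 14%N isT isT isT p1.
  have p3 := @for_progress (PFor 14 0 pass_prog) _ 13%N isT isT isT p2.
  have p4 := @for_progress (PFor 13 0 (PFor 14 0 pass_prog)) _ 12%N isT isT isT p3.
  exact: (@for_progress (PFor 12 0 (PFor 13 0 (PFor 14 0 pass_prog))) _ 11%N
            isT isT isT p4).
case=> cx fl bd [k [kn act pot]]; split=> // a na ea; rewrite leqNgt; apply/negP => la.
have [k0|] := pot; first by have := act a na ea la; rewrite k0.
(* All labels are at most [n], so the potential is at most n^3 + n^2 + n, which is below the n^4
   rounds once n is at least 2. *)
have : (sumlab st' <= n * n)%N.
  rewrite -sum_nat_const; apply: leq_sum => b _; exact: bd.
have := act a na ea la.
by rewrite add0n muln1; nia.
Qed.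

Lemma init_row_progP st a
    (st' := den (PFor 16 0 (PR 4 (cnt 15) (cnt 16) (RRead 3 (cnt 15) (cnt 16)))) st) :
  ctx st -> nmem st 15 0 0 = code a ->
  forall i j, res st' i j =
    if i == a then rmem st 3 (code a) (code j) else res st i j.
Proof.
move=> cx e15; have [n0 _ _] := cx.
pose Inv k st1 := [/\ nmem st1 15 0 0 = code a,
   forall x y, rmem st1 3 x y = rmem st 3 x y
 & forall i j, res st1 i j = if (i == a) && (code j < k)%N
     then rmem st 3 (code a) (code j) else res st i j].
suff: Inv n st' by case=> _ _ h i j; rewrite h code_lt andbT.
rewrite -n0; apply: den_for => //.
  by split=> // i j; rewrite ltn0 andbF.
rewrite n0 => k st1 /codeP[b <-] e16 [f15 f3 IH].
rewrite den_pr; split=> //= i j; rewrite -[LHS]/(write _ _ _ _ _ _ _ _) /write /=.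
rewrite f15 e16 f3 !code_eq ltnS leq_eqVlt code_eq -/(res st1 i j) IH.
by have [->|_] := eqVneq i a; have [->|_] := eqVneq j b.
Qed.

(** The zero flow, with the whole supply as excess at [v]. All labels are 0, so every residual arc
    is valid. *)
Lemma init_progP st (st' := den init_prog st) :
  ctx st -> (forall a b : V, rmem st 3 (code a) (code b) = c a b) ->
  rmem st 0 0%N 0%N = lam -> nmem st 10 0 0 = code v ->
  (forall a b, 0 <= c a b) -> 0 <= lam -> progress 0 st'.
Proof.
move=> cx c3 l0 v10 c0 lam0; have [n0 _ _] := cx.
rewrite {}/st' /init_prog den_seq; set st1 := den _ st.
have {n0} [rE [eE lE]] : (forall a b, res st1 a b = c a b) /\
    ((forall a, ex st1 a = 0) /\ (forall a, lab st1 a = 0%N)).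
  pose Inv k st2 := [/\ ctx st2, forall x y, rmem st2 3 x y = rmem st 3 x y
    & forall a, (code a < k)%N ->
        [/\ ex st2 a = 0, lab st2 a = 0%N & forall b, res st2 a b = c a b]].
  suff: Inv n st1.
    by case=> _ _ h; split=> [a b|]; [|split=> a]; have [] := h a (code_lt a).
  rewrite -n0; apply: den_for => //.
  rewrite n0 => k st2 /codeP[a <-] e15 [cx2 f3 IH].
  rewrite 2!den_seq; set st3 := den (PR _ _ _ _) _; set st4 := den _ st3.
  have cx3 : ctx st3 by do 2 apply: ctx_den => //.
  have e3 : nmem st3 15 0 0 = code a by rewrite !den_nframe.
  have r4 := init_row_progP cx3 e3.
  have e4 i : ex st4 i = if i == a then 0 else ex st2 i.
    rewrite /ex den_rframe // /st3 !denE /= /write /= e15 code_eq andbT.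
    by case: eqP.
  have l4 i : lab st4 i = if i == a then 0%N else lab st2 i.
    rewrite /lab den_nframe // /st3 !denE /= /write /= e15 code_eq andbT.
    by case: eqP.
  have c4 x y : rmem st3 3 x y = rmem st 3 x y by rewrite !den_rframe.
  split.
  - exact: (@ctx_den (PFor 16 0 _) _).
  - by move=> x y; rewrite /= den_rframe // c4.
  move=> i; rewrite ltnS leq_eqVlt code_eq => ik.
  rewrite -[ex _ i]/(ex st4 i) -[lab _ i]/(lab st4 i) e4 l4.
  have h u b : res (incr 15 st4) u b = res st4 u b by [].
  case: eqP ik => [-> _|_ /= /IH[h1 h2 h3]]; split=> // b; rewrite h r4.
    by rewrite eqxx c4.
  have [->|_] := eqVneq i a; first by rewrite c4.
  by rewrite -[RHS]h3 /res /st3 !den_rframe.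
have cx1 : ctx st1 by apply: ctx_den.
set st2 := den _ st1.
have eE2 a : ex st2 a = lam *+ (a == v).
  rewrite /ex /st2 den_pr /= /write /= den_nframe // v10 code_eq andbT.
  by rewrite den_rframe // l0; case: eqP => // _; apply: eE.
have lE2 a : lab st2 a = 0%N by rewrite -[RHS](lE a) /lab /st2 den_nframe.
have rE2 a b : res st2 a b = c a b by rewrite -[RHS]rE /res /st2 den_rframe.
split; first exact: ctx_den.
- split; last by split=> [a b|a]; rewrite !lE2.
  split=> [a b|a|a b|a]; rewrite ?rE2 ?eE2 //.
    by case: (a == v); rewrite ?mulr1n ?mulr0n.
  by rewrite big1 ?addr0 // => b _; rewrite rE2 subrr.
- by move=> a; rewrite lE2.
by exists n; split=> //; right.
Qed.

Lemma sum_progP st : ctx st ->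
  rmem (den sum_prog st) 9 0%N 0%N = \sum_(a | nsink s t a) ex st a.
Proof.
move=> cx; have [n0 _ _] := cx; rewrite /sum_prog den_seq; set st1 := den _ st.
have exE a : ex st1 a = ex st a by rewrite /ex den_rframe.
have cx1 : ctx st1 by apply: ctx_den.
pose Inv k st2 := [/\ ctx st2, forall a, ex st2 a = ex st a
  & rmem st2 9 0%N 0%N = \sum_(a | nsink s t a && (code a < k)%N) ex st a].
suff: Inv n (den (PFor 15 0 (PIf is_nsink
    (set_scal 9 (RAdd (scal 9) (rr 5 (cnt 15)))))) st1).
  by case=> _ _ ->; apply: eq_bigl => a; rewrite code_lt andbT.
have m0 : nmem st1 0 0 0 = n by case: cx1.
rewrite -m0; apply: den_for => //.
  split=> //; rewrite /st1 den_pr /= /write /= big_pred0 // => a.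
  by rewrite ltn0 andbF.
rewrite m0 => k st2 /codeP[a <-] e15 [cx2 e2 sE].
have [_ m2 m3] := cx2.
rewrite den_if /= e15 m2 m3 -!eqn_leq !code_eq -/(nsink s t a).
case na: (nsink s t a).
  rewrite den_pr; split=> //=.
  rewrite /write /= e15 sE -/(ex st2 a) e2 [in RHS](bigD1 a) ?na ?ltnSn //= addrC.
  congr (_ + _); apply: eq_bigl => b; rewrite -andbA; congr (_ && _).
  by rewrite ltnS ltn_neqAle code_eq andbC.
split=> //=; rewrite sE; apply: eq_bigl => b.
rewrite [in RHS]ltnS [in RHS]leq_eqVlt code_eq; have [->|//] := eqVneq b a.
by rewrite na.
Qed.

Lemma flow_progP st (D := rmem (den flow_prog st) 9 0%N 0%N) :
  (1 < n)%N -> ctx st -> (forall a b : V, rmem st 3 (code a) (code b) = c a b) ->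
  rmem st 0 0%N 0%N = lam -> nmem st 10 0 0 = code v ->
  (forall a b, 0 <= c a b) -> 0 <= lam ->
  (forall U : {set V}, v \in U -> s \notin U -> t \notin U -> lam - cutw c U <= D) /\
  (D = 0 \/ exists U : {set V},
     [/\ v \in U, s \notin U, t \notin U & D = lam - cutw c U]).
Proof.
move=> n1 cx c3 l0 v10 c0 lam0.
have [cx2 [pf va] act] := passes_progP n1 (init_progP cx c3 l0 v10 c0 lam0).
rewrite /D /flow_prog 2!den_seq sum_progP // -/(deficit s t (ex _)).
split; first by move=> U; apply: deficit_ge pf.
exact: (deficit_attained c0 pf va act).
Qed.

End Flow.

(** * The largest violation of the cut condition *)

Section Deficit.
Variables (R : realFieldType) (V : finType) (s t : V) (T : {set V}).
Variables (lam : R) (c : V -> V -> R).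

Lemma requiredP (U : {set V}) :
  reflect (exists v, [/\ v \in T, v \in U, s \notin U & t \notin U])
          (required s t T U).
Proof.
rewrite /required subsetC subUset !sub1set !inE.
apply: (iffP andP) => [[/andP[sU tU] /set0Pn[v]]|[v [vT vU -> ->]]].
  by rewrite inE => /andP[vT vU]; exists v.
by split=> //; apply/set0Pn; exists v; rewrite inE vT.
Qed.

(** The required sets are those containing some [v] in [T] and avoiding [s] and [t], so the largest
    of the deficits over all sources [v] in [T] is the worst violation. *)
Lemma deficit_progP (st : state R) (D := rmem (den deficit_prog st) 8 0%N 0%N) :
  (1 < #|V|)%N -> ctx s t st ->
  (forall a b : V, rmem st 3 (code a) (code b) = c a b) ->
  rmem st 0 0%N 0%N = lam ->
  (forall v : V, nmem st 3 (code v) 0 = (v \in T)) ->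
  (forall a b, 0 <= c a b) -> 0 <= lam ->
  [/\ 0 <= D, forall U, required s t T U -> lam - cutw c U <= D
    & D = 0 \/ exists2 U, required s t T U & D = lam - cutw c U].
Proof.
move=> n1 cx c3 l0 t3 c0 lam0; rewrite {}/D /deficit_prog den_seq.
set st1 := den _ st.
have cx1 : ctx s t st1 by apply: ctx_den.
have n0 : nmem st1 0 0 0 = #|V| by case: cx1.
pose Inv k (st2 : state R) := let D := rmem st2 8 0%N 0%N in
  [/\ [/\ ctx s t st2, forall x y, rmem st2 3 x y = rmem st 3 x y,
       rmem st2 0 0%N 0%N = lam & forall x, nmem st2 3 x 0 = nmem st 3 x 0],
    0 <= D,
    forall v (U : {set V}), (code v < k)%N -> v \in T -> v \in U -> s \notin U -> t \notin U ->
      lam - cutw c U <= D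
  & D = 0 \/ exists2 U, required s t T U & D = lam - cutw c U].
set p := PFor 10 0 _.
suff: Inv #|V| (den p st1).
  case=> _ D0 h1 h2; split=> // U /requiredP[v [vT vU sU tU]].
  by apply: (h1 v) => //; apply: code_lt.
rewrite -n0; apply: den_for => //.
  have D1 : rmem st1 8 0%N 0%N = 0 by rewrite /st1 den_pr.
  split=> //=; [|by rewrite D1|by left].
  by split=> //= [x y||x]; rewrite /write /= ?den_rframe // den_nframe.
rewrite n0 => k st2 /codeP[v <-] e10 [[cx2 f3 f0 g3] D0 h1 h2].
rewrite den_if /= e10 g3 t3 lt0b; case: ifP => vT; last first.
  split=> // u U; rewrite ltnS leq_eqVlt code_eq => /orP[/eqP->|]; last exact: h1.
  by rewrite vT.
rewrite den_seq.
have f3' (a b : V) : rmem st2 3 (code a) (code b) = c a b by rewrite f3 c3.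
have [ge att] := flow_progP n1 cx2 f3' f0 e10 c0 lam0.
set st3 := den flow_prog st2 in ge att *.
have D3 : rmem st3 8 0%N 0%N = rmem st2 8 0%N 0%N by rewrite den_rframe.
have cx3 : ctx s t st3 by apply: ctx_den.
set D := rmem st3 9 0%N 0%N in ge att; set b := BLt _ _.
have st4E : nmem (den (PIf b (set_scal 8 (scal 9))) st3) = nmem st3.
  by rewrite den_if; case: ifP => _ //; rewrite den_pr.
set st4 := den _ st3 in st4E *.
have D4 : rmem st4 8 0%N 0%N = Num.max (rmem st2 8 0%N 0%N) D.
  by rewrite /st4 den_if /= D3 -/D; case: leP => //= h; rewrite den_pr.
split=> /=.
- split.
  + by rewrite /ctx /= /write /= st4E; case: cx3.
  + by move=> x y; rewrite /st4 !den_rframe.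
  + by rewrite /st4 !den_rframe.
  + by move=> x; rewrite /write /= st4E den_nframe.
- by rewrite D4 le_max D0.
- move=> u U; rewrite ltnS leq_eqVlt code_eq D4 le_max => /orP[/eqP->|uv] uT uU sU tU.
    by rewrite (ge U) ?orbT.
  by rewrite (h1 u U).
rewrite D4; case: leP => _ //; case: att => [|[U [vU sU tU E]]]; first by left.
by right; exists U => //; apply/requiredP; exists v.
Qed.

End Deficit.

(** * Splitting off lists of triples *)

Lemma sum_option (R : zmodType) (I : finType) (F : option I -> R) :
  \sum_x F x = F None + \sum_i F (Some i).
Proof.
rewrite (bigD1 None) //=; congr (_ + _).
rewrite (reindex_omap Some id) => [|[]] //=.
by apply: eq_bigl => i; rewrite eqxx.
Qed.

Section SplitLists.
Variables (R : realFieldType) (V : finType).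
Implicit Type F : V -> V -> R.

(** Cuts, capacities and the degrees at [z] all have this form, so one formula describes how
    splitting off changes each of them. *)
Definition edge_sum (G : wdigraph R V) F :=
  \sum_(x : edge G) weight x * F (tail x) (head x).

Definition split_change (G : wdigraph R V) F (e f : edge G) :=
  F (tail e) (head f) - F (tail e) (head e) - F (tail f) (head f).

Lemma split_off_sum (G : wdigraph R V) F (e f : edge G) gamma :
  edge_sum (split_off e f gamma) F = edge_sum G F + gamma * split_change F e f.
Proof.
rewrite /edge_sum /split_change sum_option /=.
have E g : \sum_(i : edge G) (gamma *+ (i == g)) * F (tail i) (head i) =
    gamma * F (tail g) (head g).
  rewrite (bigD1 g) //= eqxx mulr1n big1 ?addr0 // => i /negPf->.
  by rewrite mulr0n mul0r.
rewrite (eq_bigr (fun i : edge G => weight i * F (tail i) (head i)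
  - (gamma *+ (i == e)) * F (tail i) (head i)
  - (gamma *+ (i == f)) * F (tail i) (head i))); last by move=> i _; ring.
rewrite !sumrB !E; ring.
Qed.

Lemma split_off_list_sum E0 (l : seq (E0 * E0 * R)) (G : wdigraph R V)
    (emb : E0 -> edge G) F :
  edge_sum (split_off_list l emb) F =
  edge_sum G F + \sum_(p <- l) p.2 * split_change F (emb p.1.1) (emb p.1.2).
Proof.
elim: l G emb => [|[[e f] g] l IH] G emb /=; first by rewrite big_nil addr0.
by rewrite IH split_off_sum big_cons /= -addrA.
Qed.

(** The program appends triples at the end of the list, whereas [split_off_list] works from its
    front; additivity of the changes reconciles the two. *)
Lemma split_off_all_rcons (G : wdigraph R V) (l : seq (edge G * edge G * R)) p F :
  edge_sum (split_off_all (rcons l p)) F =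
  edge_sum (split_off_all l) F + p.2 * split_change F p.1.1 p.1.2.
Proof. by rewrite !split_off_list_sum big_rcons /= addrA. Qed.

Lemma total_edge_sum (G : wdigraph R V) (A : {set edge G}) (m : V -> V -> bool) :
  (forall x, (x \in A) = m (tail x) (head x)) ->
  total A = edge_sum G (fun a b => (m a b)%:R).
Proof. by move=> h; rewrite totalE; apply: eq_bigr => x _; rewrite h mulr_natr. Qed.

(** Each edge is either a copy of an old one with reduced weight, or was created from a tail and a
    head different from [z]. *)
Lemma split_off_list_edge (E0 : eqType) (l : seq (E0 * E0 * R)) (G : wdigraph R V)
    (emb : E0 -> edge G) z :
  (forall e f g, (e, f, g) \in l ->
     [/\ tail (emb e) != z, head (emb f) != z & 0 <= g]) ->
  forall x : edge (split_off_list l emb),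
  (exists y : edge G, [/\ tail x = tail y, head x = head y &
     weight x = weight y -
       \sum_(p <- l) p.2 *+ ((y == emb p.1.1) + (y == emb p.1.2))]) \/
  [/\ tail x != z, head x != z & 0 <= weight x].
Proof.
elim: l G emb => [|[[e f] g] l IH] G emb h x /=.
  by left; exists x; rewrite big_nil subr0.
have [|[[y|] [-> -> ->]]|] := IH (split_off (emb e) (emb f) g) (fun a => Some (emb a)) _ x;
  last by right.
- by move=> e1 f1 g1 h1; apply: h; rewrite inE h1 orbT.
- by left; exists y; split=> //=; rewrite big_cons /= mulrnDr; ring.
(* The new edge [None] is not in the image of the embedding, so later triples leave its weight
   alone. *)
right; have [h1 h2 g0] := h e f g (mem_head _ _).
by split=> //=; rewrite big1 ?subr0.
Qed.

End SplitLists.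

(** * Cuts and remaining weights while splitting off at [z] *)

Section SplitZ.
Variables (R : realFieldType) (V : finType) (G : wdigraph R V).
Variables (s t z : V) (T : {set V}) (lam : R).
Implicit Types (l : seq (edge G * edge G * R)) (e f : edge G) (U : {set V}).
Hypothesis balanced : total (delta_in G [set z]) = total (delta_out G [set z]).
Hypothesis z_notin : z \notin [set s; t] :|: T.

Definition rest l e : R :=
  weight e - \sum_(p <- l) p.2 *+ ((e == p.1.1) + (e == p.1.2)).

Lemma rest_rcons l p e :
  rest (rcons l p) e = rest l e - p.2 *+ ((e == p.1.1) + (e == p.1.2)).
Proof. by rewrite /rest big_rcons /=; ring. Qed.

Definition in_z e := (tail e != z) && (head e == z).
Definition out_z f := (tail f == z) && (head f != z).

Lemma in_zE e : (e \in delta_in G [set z]) = in_z e.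
Proof. by rewrite !inE. Qed.

Lemma out_zE f : (f \in delta_out G [set z]) = out_z f.
Proof. by rewrite !inE. Qed.

Definition at_z l := forall p, p \in l -> [/\ in_z p.1.1, out_z p.1.2 & 0 <= p.2].

Definition cutl l U := total (delta (split_off_all l) U).

(** The symmetric indicator of one edge. A loop gives 2 on the diagonal, matching the two writes of
    [add_edge_prog], and crosses no cut. *)
Definition adj (u w a b : V) : R :=
  ((a == u) && (b == w))%:R + ((a == w) && (b == u))%:R.

Definition cap l a b := edge_sum (split_off_all l) (fun u w => adj u w a b).

(** The sets whose cut drops when [e], entering [z], and [f], leaving [z], are split off; other cuts
    are unchanged. *)
Definition turns U e f := ((tail e \in U) == (head f \in U)) && ((z \in U) != (tail e \in U)).

Lemma cutlE l U : cutl l U = edge_sum (split_off_all l) (fun a b => (crosses U a b)%:R).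
Proof. by apply: total_edge_sum => x; rewrite mem_delta. Qed.

Lemma cutl_rcons l e f g U : in_z e -> out_z f ->
  cutl (rcons l (e, f, g)) U = cutl l U - (g *+ 2) *+ turns U e f.
Proof.
case/andP=> _ /eqP hz /andP[/eqP tz _].
rewrite !cutlE split_off_all_rcons /split_change /= hz tz /turns /crosses.
by do 3 case: (_ \in U) => /=; rewrite ?mulr1n ?mulr0n; ring.
Qed.

Lemma cap_rcons l e f g a b : in_z e -> out_z f ->
  cap (rcons l (e, f, g)) a b =
  cap l a b + g * (adj (tail e) (head f) a b - adj (tail e) z a b - adj z (head f) a b).
Proof.
case/andP=> _ /eqP hz /andP[/eqP tz _].
by rewrite /cap split_off_all_rcons /split_change /= hz tz.
Qed.

Lemma cutw_adj U u w : cutw (adj u w) U = (crosses U u w)%:R.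
Proof.
rewrite /cutw.
have E x y : \sum_(a in U) \sum_(b in ~: U) ((a == x) && (b == y))%:R =
    ((x \in U) && (y \notin U))%:R :> R.
  rewrite pair_big_dep /= (eq_bigr (fun p : V * V => (p == (x, y))%:R)); last first.
    by case=> a b _; rewrite xpair_eqE.
  have [/andP[xU yU]|h] := boolP (_ && _).
    rewrite (bigD1 (x, y)) /= ?xU ?inE //= eqxx big1 ?addr0 // => p /andP[_ /negPf->].
    by [].
  apply: big1 => -[a b] /andP[/= aU]; rewrite inE => bU; case: eqP => // -[ax yb].
  by rewrite -ax -yb aU bU in h.
transitivity (\sum_(a in U) \sum_(b in ~: U) ((a == u) && (b == w))%:R +
  \sum_(a in U) \sum_(b in ~: U) ((a == w) && (b == u))%:R : R).
  by rewrite -big_split; apply: eq_bigr => a _; rewrite -big_split.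
by rewrite !E /crosses; do 2 case: (_ \in U); rewrite /= ?addr0 ?add0r.
Qed.

Lemma cutw_cap l U : cutw (cap l) U = cutl l U.
Proof.
rewrite cutlE /cutw /cap /edge_sum.
under eq_bigr do rewrite exchange_big /=.
rewrite exchange_big /=; apply: eq_bigr => x _.
rewrite -cutw_adj /cutw mulr_sumr; apply: eq_bigr => a _.
by rewrite mulr_sumr.
Qed.

Lemma at_z_edge l (x : edge (split_off_all l)) : at_z l ->
  (exists y : edge G, [/\ tail x = tail y, head x = head y & weight x = rest l y]) \/
  [/\ tail x != z, head x != z & 0 <= weight x].
Proof.
move=> h; apply: split_off_list_edge => e f g efg.
by have [/andP[te _] /andP[_ hf] g0] := h _ efg.
Qed.

Lemma split_weight_ge0 l (x : edge (split_off_all l)) :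
  at_z l -> (forall e, 0 <= rest l e) -> 0 <= weight x.
Proof. by move=> lz r0; have [[y [_ _ ->]]|[]] := at_z_edge x lz. Qed.

Lemma cap_ge0 l a b : at_z l -> (forall e, 0 <= rest l e) -> 0 <= cap l a b.
Proof.
move=> lz r0; apply: sumr_ge0 => x _; apply: mulr_ge0; first exact: split_weight_ge0.
by rewrite addr_ge0 ?ler0n.
Qed.

Definition good l :=
  [/\ forall p, p \in l -> [/\ in_z p.1.1, out_z p.1.2 & 0 < p.2],
      forall e, 0 <= rest l e
    & forall U, required s t T U -> lam <= cutl l U].

Lemma good_at_z l : good l -> at_z l.
Proof. by case=> h _ _ p /h[? ? /ltW]. Qed.

Definition exhausted l e f :=
  [\/ rest l e = 0, rest l f = 0
    | exists U, [/\ required s t T U, cutl l U = lam & turns U e f]].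

(** Each triple removes the same amount on both sides of [z], and its new edge avoids [z]. *)
Lemma split_balanced l : at_z l ->
  total (delta_in (split_off_all l) [set z]) =
  total (delta_out (split_off_all l) [set z]).
Proof.
move=> lz.
have Ein (H : wdigraph R V) : total (delta_in H [set z]) =
    edge_sum H (fun a b => ((a != z) && (b == z))%:R).
  by apply: total_edge_sum => x; rewrite !inE.
have Eout (H : wdigraph R V) : total (delta_out H [set z]) =
    edge_sum H (fun a b => ((a == z) && (b != z))%:R).
  by apply: total_edge_sum => x; rewrite !inE.
move: balanced; rewrite !Ein !Eout !split_off_list_sum => ->; congr (_ + _).
apply: eq_big_seq => p /lz[/andP[/negPf h1 /eqP h2] /andP[/eqP h3 /negPf h4] _].
by rewrite /split_change h2 h3 h1 h4 eqxx /= ?eqxx ?h1 ?h4 /=; ring.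
Qed.

(** Edges at [z] are copies of original ones. For two of positive weight, exhaustion can only mean a
    tight set, which blocks them. *)
Lemma exhausted_isolated l : good l ->
  (forall e f, in_z e -> out_z f -> exhausted l e f) ->
  forall x : edge (split_off_all l),
    x \in delta (split_off_all l) [set z] -> weight x = 0.
Proof.
move=> gl ex; have lz := good_at_z gl; have [_ r0 cl] := gl.
apply: (@unsplittable_isolated _ _ _ _ s t z T lam).
- by move=> x; apply: split_weight_ge0.
- exact: split_balanced.
- exact: z_notin.
- by move=> U h1 h2; apply: cl; rewrite /required h1.
move=> x y; rewrite !inE => /andP[tx hx] /andP[ty hy].
have [[e [et eh ew]]|[_ hz]] := at_z_edge x lz; last by rewrite hx in hz.
have [[f [ft fh fw]]|[tz]] := at_z_edge y lz; last by rewrite ty in tz.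
rewrite ew fw => e0 f0.
have ein : in_z e by rewrite /in_z -et tx -eh.
have fout : out_z f by rewrite /out_z -ft ty -fh.
have [] := ex e f ein fout.
- by move=> h; rewrite h ltxx in e0.
- by move=> h; rewrite h ltxx in f0.
case=> U [rU tU /andP[h1 h2]]; exists U.
by rewrite /blocks rU -/(cutl l U) tU eqxx et fh h1.
Qed.

Lemma in_z_neq_out_z e f : in_z e -> out_z f -> e != f.
Proof.
by move=> /andP[h _] /andP[tf _]; apply: contraNneq h => ->.
Qed.

Lemma rest_rcons_ge0 l e f g : (forall x, 0 <= rest l x) -> in_z e -> out_z f ->
  g <= rest l e -> g <= rest l f -> forall x, 0 <= rest (rcons l (e, f, g)) x.
Proof.
move=> r0 ein fout ge gf x; rewrite rest_rcons /=.
have /negPf ef := in_z_neq_out_z ein fout.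
have [->|_] := eqVneq x e; first by rewrite ef addn0 mulr1n subr_ge0.
have [->|_] := eqVneq x f; first by rewrite /= add0n mulr1n subr_ge0.
by rewrite /= mulr0n subr0.
Qed.

(* Splitting off the largest conceivable amount lowers the cuts of the sets
   with [turns] by the same amount [2 * g0], so that half of the resulting
   deficit [D] is what has to be given back. *)
Lemma split_step l e f (D : R) (g0 := Num.min (rest l e) (rest l f))
    (g := g0 - D / 2) :
  good l -> in_z e -> out_z f -> 0 <= D ->
  (forall U, required s t T U -> lam - cutl (rcons l (e, f, g0)) U <= D) ->
  D = 0 \/ (exists2 U, required s t T U & D = lam - cutl (rcons l (e, f, g0)) U) ->
  exists l', [/\ l' = (if 0 < g then rcons l (e, f, g) else l),
    good l', exhausted l' e f,
    (forall e' f', exhausted l e' f' -> exhausted l' e' f')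
  & (forall x, rest l' x = rest l x - g *+ ((x == e) + (x == f))) /\
    (forall a b, cap l' a b = cap l a b + g *
       (adj (tail e) (head f) a b - adj (tail e) z a b - adj z (head f) a b))].
Proof.
move=> gl ein fout D0 Dge Datt; have [l_at r0 cl] := gl.
have g0e : g0 <= rest l e by rewrite ge_min lexx.
have g0f : g0 <= rest l f by rewrite ge_min lexx orbT.
have g00 : 0 <= g0 by rewrite le_min !r0.
have ef := in_z_neq_out_z ein fout.
have cutE h U : cutl (rcons l (e, f, h)) U = cutl l U - (h *+ 2) *+ turns U e f.
  exact: cutl_rcons.
(* All required cuts were at least [lam] before and have dropped by at most [2 * g0]. Hence giving
   back half of [D] leaves [g] nonnegative. *)
have Dle : D <= g0 *+ 2.
  case: Datt => [->|[U rU ->]]; first by rewrite mulrn_wge0.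
  have := cl U rU; rewrite cutE; case: (turns U e f); rewrite ?mulr1n ?mulr0n => h;
    by move: h g00; rewrite ?mulr2n; lra.
have ge0 : 0 <= g by rewrite /g; move: Dle; rewrite mulr2n; lra.
set l' := if 0 < g then _ else l; exists l'.
have restE x : rest l' x = rest l x - g *+ ((x == e) + (x == f)).
  rewrite /l'; case: ltP => [_|g_0]; first by rewrite rest_rcons.
  have -> : g = 0 by apply/le_anti; rewrite g_0 ge0.
  by rewrite mul0rn subr0.
have cutE' U : cutl l' U = cutl l U - (g *+ 2) *+ turns U e f.
  rewrite /l'; case: ltP => [_|g_0]; first exact: cutE.
  have -> : g = 0 by apply/le_anti; rewrite g_0 ge0.
  by rewrite !mul0rn subr0.
have gg0 : g <= g0 by rewrite /g; lra.
have rest' x : 0 <= rest l' x.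
  rewrite /l'; case: ifP => // _.
  by apply: rest_rcons_ge0 => //; apply: le_trans gg0 _.
(* Giving back [D / 2] raises every cut that had dropped by exactly [D], the largest violation. *)
have cut' U : required s t T U -> lam <= cutl l' U.
  move=> rU; have := cl U rU; have := Dge U rU; rewrite cutE cutE' !mulr2n /g.
  by case: (turns U e f); rewrite ?mulr1n ?mulr0n; lra.
have cut_le U : cutl l' U <= cutl l U.
  by rewrite cutE' gerBl; do 2 apply: mulrn_wge0.
have rest_le x : rest l' x <= rest l x by rewrite restE gerBl mulrn_wge0.
split=> //.
- split=> // p; rewrite /l'; case: ifP => [gp|_]; last exact: l_at.
  by rewrite mem_rcons inE => /orP[/eqP->|/l_at].
(* If [D = 0], the full [g0] is split off and one of the two edges runs out. Otherwise the set
   attaining [D] becomes tight; it must turn, since an unchanged cut is not violated. *)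
- have [D_0|Dn0] := eqVneq D 0.
    have gE : g = g0 by rewrite /g D_0; lra.
    rewrite /exhausted !restE !eqxx (negPf ef) [f == e]eq_sym (negPf ef) gE.
    by rewrite /g0; case: leP => _; [constructor 1|constructor 2]; rewrite subrr.
  case: Datt => [/eqP|[U rU DU]]; first by rewrite (negPf Dn0).
  constructor 3; exists U; have := cl U rU.
  case tU: (turns U e f) (cutE g0 U) (cutE' U); rewrite ?mulr1n ?mulr0n => E1 E2 h.
    by split=> //; rewrite E2; move: DU; rewrite E1 /g; lra.
  by case/eqP: Dn0; apply/le_anti; rewrite D0 DU E1; lra.
(* Weights and cuts never grow, so zero weights and tight sets persist. *)
- move=> e' f' [h|h|[U [rU tU hU]]]; [constructor 1|constructor 2|constructor 3].
  + by apply/le_anti; rewrite rest' -h rest_le.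
  + by apply/le_anti; rewrite rest' -h rest_le.
  + by exists U; split=> //; apply/le_anti; rewrite cut' // -tU cut_le.
split=> // a b; rewrite /l'; case: ltP => [_|g_0]; first exact: cap_rcons.
have -> : g = 0 by apply/le_anti; rewrite g_0 ge0.
by rewrite mul0r addr0.
Qed.

End SplitZ.

(** * Correctness of the program *)

Section Correctness.
Variables (R : realFieldType) (V : finType) (G : wdigraph R V).
Variables (s t z : V) (T : {set V}) (lam : R).
Implicit Types (l : seq (edge G * edge G * R)) (e f : edge G) (st : state R).
Hypothesis w_ge0 : forall e : edge G, 0 <= weight e.
Hypothesis z_notin : z \notin [set s; t] :|: T.
Hypothesis lam_ge0 : 0 <= lam.
Hypothesis cut_ge : cut_condition G s t T lam.

Lemma neval_nmem st st' x : nmem st = nmem st' -> neval st x = neval st' x.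
Proof. by move=> E; elim: x => //= [a i -> j ->|e1 -> e2 ->|e1 -> e2 ->]; rewrite ?E. Qed.

(** The last hypothesis says that the value of [r] does not depend on array 3, which changes between
    the two writes. *)
Lemma add_edge_progP st u w r (a b : V) :
  neval st u = code a -> neval st w = code b ->
  (forall i j y, reval (setr st 3 i j y) r = reval st r) ->
  forall i j : V, rmem (den (add_edge_prog u w r) st) 3 (code i) (code j) =
    rmem st 3 (code i) (code j) + reval st r * adj R a b i j.
Proof.
move=> eu ew er i j; rewrite /add_edge_prog den_seq; set st1 := den _ st.
have [eu1 ew1] : neval st1 u = code a /\ neval st1 w = code b.
  by rewrite -eu -ew /st1 den_pr; split; apply: neval_nmem.
rewrite den_pr /= eu1 ew1 /st1 den_pr er /= eu ew /write /= !code_eq /adj.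
have [/andP[/eqP-> /eqP->]|_] := boolP ((i == b) && (j == a)).
  have [->|ba] := eqVneq b a; rewrite ?eqxx /=; last by rewrite add0r mulr1.
  by ring.
have [/andP[/eqP-> /eqP->]|_] := boolP ((i == a) && (j == b)).
  by rewrite addr0 mulr1.
by rewrite addr0 mulr0 addr0.
Qed.

Record static st : Prop := Static {
  st_ctx : ctx s t st;
  st_m : nmem st 0 1 0 = #|edge G|;
  st_z : nmem st 0 4 0 = code z;
  st_tail : forall e, nmem st 1 (code e) 0 = code (tail e);
  st_head : forall e, nmem st 2 (code e) 0 = code (head e);
  st_T : forall v : V, nmem st 3 (code v) 0 = (v \in T);
  st_lam : rmem st 0 0%N 0%N = lam }.

Lemma static_eq st st' :
  (forall a i, (a < 4)%N -> nmem st' a i 0 = nmem st a i 0) ->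
  rmem st' 0 0%N 0%N = rmem st 0 0%N 0%N -> static st -> static st'.
Proof.
by move=> En Er [[? ? ?] ? ? ? ? ? ?]; split=> [|||e|e|v|]; rewrite ?Er ?En //; split;
  rewrite En.
Qed.

Lemma static_den p st : wf p -> all (fun a => 4 <= a)%N (nwrites p) ->
  0%N \notin rwrites p -> static st -> static (den p st).
Proof.
move=> wp /allP h rp; apply: static_eq => [a i a4|]; last by rewrite den_rframe.
by rewrite den_nframe //; apply: contraTN a4 => /h; rewrite -leqNgt.
Qed.

Lemma split_progP st e f : static st ->
  nmem st 8 0 0 = code e -> nmem st 9 0 0 = code f ->
  forall a b : V, rmem (den split_prog st) 3 (code a) (code b) =
    rmem st 3 (code a) (code b) + rmem st 6 0%N 0%N *
      (adj R (tail e) (head f) a b - adj R (tail e) z a b - adj R z (head f) a b).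
Proof.
move=> S e8 f9 a b; rewrite /split_prog 2!den_seq.
set st1 := den _ st; set st2 := den _ st1.
have N1 : forall x i j, nmem st1 x i j = nmem st x i j by move=> *; rewrite den_nframe.
have N2 : forall x i j, nmem st2 x i j = nmem st x i j.
  by move=> *; rewrite den_nframe // N1.
have R1 : rmem st1 6 0%N 0%N = rmem st 6 0%N 0%N by rewrite den_rframe.
have R2 : rmem st2 6 0%N 0%N = rmem st 6 0%N 0%N by rewrite !den_rframe.
have [_ _ Sz St Sh _ _] := S.
rewrite (@add_edge_progP _ _ _ _ (tail e) (head f)) //=; last first.
- by rewrite !N2 f9 Sh.
- by rewrite !N2 e8 St.
rewrite (@add_edge_progP _ _ _ _ z (head f)) //=; last first.
- by rewrite !N1 f9 Sh.
- by rewrite !N1 Sz.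
rewrite (@add_edge_progP _ _ _ _ (tail e) z) //=; last first.
- by rewrite e8 St.
by rewrite R1 R2; ring.
Qed.

Definition tracks l st :=
  [/\ forall e, rmem st 1 (code e) 0%N = rest l e,
      forall a b : V, rmem st 3 (code a) (code b) = cap l a b
    & outputs st l].

Lemma outputs_eq st st' l :
  (forall a i, a \in [:: 4; 5; 6]%N -> nmem st' a i 0 = nmem st a i 0) ->
  (forall i, rmem st' 2 i 0%N = rmem st 2 i 0%N) -> outputs st l -> outputs st' l.
Proof.
move=> En Er [h1 h2 h3 h4]; split; first by rewrite En.
- by rewrite -h2; apply: eq_map => i; rewrite En.
- by rewrite -h3; apply: eq_map => i; rewrite En.
by rewrite -h4; apply: eq_map => i; rewrite Er.
Qed.

Lemma output_progP st e f l : nmem st 8 0 0 = code e -> nmem st 9 0 0 = code f ->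
  outputs st l -> outputs (den output_prog st) (rcons l (e, f, rmem st 7 0%N 0%N)).
Proof.
move=> e8 f9 [h1 h2 h3 h4].
have iE (A : Type) (g g' : nat -> A) x : (forall i, (i < size l)%N -> g' i = g i) ->
    g' (size l) = x ->
  [seq g' i | i <- iota 0 (size l).+1] = rcons [seq g i | i <- iota 0 (size l)] x.
  move=> h hx; rewrite -addn1 iotaD map_cat /= add0n hx cats1; congr rcons.
  by apply/eq_in_map => i; rewrite mem_iota /= add0n; apply: h.
have ne i : (i < size l)%N -> (i == size l) = false by move=> h; rewrite ltn_eqF.
set st' := den output_prog st.
have m5 i : nmem st' 5 i 0 = if i == size l then code e else nmem st 5 i 0.
  by rewrite /st' /output_prog !denE /= /write /= h1 andbT e8.
have m6 i : nmem st' 6 i 0 = if i == size l then code f else nmem st 6 i 0.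
  by rewrite /st' /output_prog !denE /= /write /= h1 andbT f9.
have m2 i : rmem st' 2 i 0%N =
    if i == size l then rmem st 7 0%N 0%N else rmem st 2 i 0%N.
  by rewrite /st' /output_prog !denE /= /write /= h1 andbT.
split; rewrite ?size_rcons ?map_rcons -?h2 -?h3 -?h4.
- by rewrite /st' /output_prog !denE /= /write /= h1 addn1.
- by apply: iE => [i /ne h|]; rewrite m5 ?h ?eqxx.
- by apply: iE => [i /ne h|]; rewrite m6 ?h ?eqxx.
- by apply: iE => [i /ne h|]; rewrite m2 ?h ?eqxx.
Qed.

Lemma pair_progP st l e f : static st -> tracks l st -> good s t z T lam l ->
  nmem st 8 0 0 = code e -> nmem st 9 0 0 = code f -> in_z z e -> out_z z f ->
  exists l', [/\ tracks l' (den pair_prog st), good s t z T lam l',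
    exhausted s t z T lam l' e f
  & forall e' f', exhausted s t z T lam l e' f' -> exhausted s t z T lam l' e' f'].
Proof.
move=> S [trw trc tro] gl e8 f9 ein fout.
rewrite /pair_prog den_seq; set sa := den _ st.
rewrite den_seq; set s1 := den _ sa.
pose g0 := Num.min (rest l e) (rest l f).
have S1 : static s1 by apply: static_den => //; apply: static_den.
have g1 : rmem s1 7 0%N 0%N = g0.
  rewrite /s1 den_if /sa !den_pr /= /write /= e8 f9 !trw /g0 minC.
  by case: leP => h; rewrite ?denE /= /write /= ?f9 ?trw.
have n1 x i j : nmem s1 x i j = nmem st x i j by rewrite !den_nframe.
have c1 i j : rmem s1 3 i j = rmem st 3 i j by rewrite !den_rframe.
rewrite den_seq; set s2 := den _ s1.
have S2 : static s2 by apply: static_den.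
have g2 : rmem s2 6 0%N 0%N = g0 by rewrite /s2 den_pr.
rewrite den_seq; set s3 := den _ s2.
have S3 : static s3 by apply: static_den.
have c3 (a b : V) : rmem s3 3 (code a) (code b) = cap (rcons l (e, f, g0)) a b.
  rewrite (@split_progP _ e f) ?g2 ?[rmem s2 _ _ _]den_rframe ?c1 ?trc //.
  - by rewrite (cap_rcons _ _ _ _ ein fout).
  - by rewrite den_nframe // n1.
  - by rewrite den_nframe // n1.
rewrite den_seq; set s4 := den _ s3.
have S4 : static s4 by apply: static_den.
set l0 := rcons l (e, f, g0) in c3.
have [l_at r0 _] := gl.
have g00 : 0 <= g0 by rewrite le_min !r0.
have cap0 a b : 0 <= cap l0 a b.
  apply: (@cap_ge0 _ _ _ z).
    by move=> p; rewrite mem_rcons inE => /orP[/eqP->|/l_at[? ? /ltW]].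
  by apply: (rest_rcons_ge0 r0 ein fout); rewrite ge_min lexx ?orbT.
(* The bound on the number of rounds asks for two vertices; [z] and [s] are distinct. *)
have V1 : (1 < #|V|)%N.
  apply/card_gt1P; exists z, s; split=> //.
  by apply: contraNneq z_notin => ->; rewrite !inE eqxx.
have [D0 Dge Datt] := deficit_progP V1 (st_ctx S3) c3 (st_lam S3) (st_T S3) cap0 lam_ge0.
set D := rmem (den deficit_prog s3) 8 0%N 0%N in D0 Dge Datt.
have [||l' [l'E gl' exl' mono [rest' cap']]] := split_step gl ein fout D0.
- by move=> U rU; rewrite -cutw_cap; apply: Dge.
- by case: Datt => [|[U rU ->]]; [left|right; exists U => //; rewrite cutw_cap].
set g := Num.min _ _ - D / 2 in l'E rest' cap'.
exists l'; split=> //.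
have n4 x i j : x \in [:: 1; 2; 4; 5; 6; 8; 9]%N -> nmem s4 x i j = nmem st x i j.
  by rewrite !inE; do !case/orP; move/eqP->; rewrite !den_nframe.
have g4 : rmem s4 7 0%N 0%N = g0 by rewrite /s4 den_rframe // /s3 den_rframe // /s2 den_rframe // g1.
have c4 (a b : V) : rmem s4 3 (code a) (code b) = cap l0 a b by rewrite den_rframe.
rewrite den_seq; set s5 := den _ s4; rewrite den_seq; set s6 := den _ s5.
have S5 : static s5 by apply: static_den.
(* The amounts [g0] and [- D / 2] add up to [g], so the capacities are those obtained by splitting
   off [g] alone. *)
have c6 (a b : V) : rmem s6 3 (code a) (code b) = cap l' a b.
  have e5 : nmem s5 8 0 0 = code e by rewrite /s5 den_nframe // n4.
  have f5 : nmem s5 9 0 0 = code f by rewrite /s5 den_nframe // n4.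
  have c5 : rmem s5 3 (code a) (code b) = cap l0 a b by rewrite /s5 den_rframe.
  have g5 : rmem s5 6 0%N 0%N = 0 - D / 2 by rewrite /s5 den_pr.
  rewrite (split_progP S5 e5 f5) c5 g5.
  by rewrite cap' (cap_rcons _ _ _ _ ein fout) /g -/g0; ring.
rewrite den_seq; set s7 := den _ s6.
have g7 : rmem s7 7 0%N 0%N = g.
  have g6 : rmem s6 7 0%N 0%N = g0 by rewrite /s6 den_rframe // /s5 den_rframe.
  have D6 : rmem s6 8 0%N 0%N = D by rewrite /s6 den_rframe // /s5 den_rframe.
  by rewrite /s7 den_pr /= /write /= g6 D6.
rewrite den_seq; set s8 := den _ s7; rewrite den_seq; set s9 := den _ s8.
have n9 x i j : x \in [:: 4; 5; 6; 8; 9]%N -> nmem s9 x i j = nmem st x i j.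
  by rewrite !inE; do !case/orP; move/eqP->; rewrite !den_nframe.
have [n78 n79] : nmem s7 8 0 0 = code e /\ nmem s7 9 0 0 = code f.
  by rewrite !den_nframe.
have r9 x : rmem s9 1 (code x) 0%N = rest l' x.
  have r7 y : rmem s7 1 (code y) 0%N = rest l y by rewrite !den_rframe.
  have /negPf ef := in_z_neq_out_z ein fout.
  rewrite rest' /s9 den_pr /s8 den_pr /= /write /= n78 n79 !code_eq !r7 g7.
  have [->|xf] := eqVneq x f; rewrite ?[f == e]eq_sym ?ef ?andbT /= ?add0n ?addn0 //.
  by have [->|_] := eqVneq x e; rewrite ?subr0.
have g9 : rmem s9 7 0%N 0%N = g.
  by rewrite -g7 /s9 den_rframe; [rewrite /s8 den_rframe|].
have c9 i j : rmem s9 3 i j = rmem s6 3 i j.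
  by rewrite /s9 den_rframe; [rewrite /s8 den_rframe; [rewrite /s7 den_rframe|]|].
have o9 : outputs s9 l.
  apply: outputs_eq tro => [x i hx|i]; last by rewrite !den_rframe.
  by apply: n9; move: hx; rewrite !inE; do !case/orP; move/eqP->.
split.
- by move=> x; rewrite den_rframe; [exact: r9|].
- by move=> a b; rewrite den_rframe; [rewrite c9|].
rewrite den_if /= g9 -ltNge l'E; case: ifP => // gp.
by rewrite -g9; apply: output_progP; rewrite ?n9.
Qed.

Definition all_exhausted l (P : edge G -> edge G -> bool) :=
  forall e f, in_z z e -> out_z z f -> P e f -> exhausted s t z T lam l e f.

(** [P] marks the pairs treated so far; both nested loops carry this invariant. *)
Definition state_ok P st := exists l,
  [/\ static st, tracks l st, good s t z T lam l & all_exhausted l P].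

Lemma state_ok_eq P st st' :
  (forall a i, (a < 7)%N -> nmem st' a i 0 = nmem st a i 0) ->
  (forall a i j, rmem st' a i j = rmem st a i j) -> state_ok P st -> state_ok P st'.
Proof.
move=> En Er [l [S [h1 h2 h3] gl ex]]; exists l; split=> //.
- by apply: static_eq S => [a i ha|]; [rewrite En //; lia|rewrite Er].
- split=> [e|a b|]; rewrite ?Er //; apply: outputs_eq h3 => [a i|i]; last by rewrite Er.
  by rewrite !inE => ha; rewrite En //; lia.
Qed.

Lemma inner_progP st e (P : edge G -> edge G -> bool) :
  in_z z e -> nmem st 8 0 0 = code e -> state_ok P st ->
  state_ok (fun e' f' => P e' f' || (e' == e))
    (den (PFor 9 1 (PIf (BAnd (BEq (rd 1 (cnt 9)) vZ) (BNot (BEq (rd 2 (cnt 9)) vZ)))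
       pair_prog)) st).
Proof.
move=> ein e8 ok; have [l0 [S0 _ _ _]] := ok.
pose Inv k st1 := nmem st1 8 0 0 = code e /\
  state_ok (fun e' f' => P e' f' || (e' == e) && (code f' < k)%N) st1.
set p := PFor _ _ _.
suff: Inv #|edge G| (den p st).
  case=> _ [l [S tr gl ex]]; exists l; split=> // e' f' h1 h2.
  by move=> h3; apply: ex; rewrite // code_lt andbT.
rewrite -(st_m S0); apply: den_for => //.
  split=> //; apply: state_ok_eq (_ : state_ok _ st) => //.
    by move=> a i a7; rewrite /= /write; case: eqP => // h; rewrite h in a7.
  case: ok => l [S tr gl ex]; exists l; split=> // e' f' h1 h2.
  by rewrite ltn0 andbF orbF; apply: ex.
rewrite (st_m S0) => k st1 /codeP[f <-] e9 [f8 [l [S tr gl ex]]].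
split.
  by rewrite /= /write /= den_nframe.
set st2 := den _ st1.
apply: (@state_ok_eq _ st2) => //.
  by move=> a i a7; rewrite /= /write; case: eqP => // h; rewrite h in a7.
rewrite /st2 den_if /= e9 (st_tail S) (st_head S) (st_z S) -!eqn_leq !code_eq.
rewrite -/(out_z z f); case: ifP => fout; last first.
  exists l; split=> // e' f' h1 h2; rewrite ltnS leq_eqVlt code_eq => h3.
  have f'f : f' != f by apply: contraTneq h2 => ->; rewrite fout.
  by rewrite (negPf f'f) in h3; apply: ex.
have [l' [tr' gl' ex' mono]] := pair_progP S tr gl f8 e9 ein fout.
exists l'; split=> //; first exact: static_den.
move=> e' f' h1 h2; rewrite ltnS leq_eqVlt code_eq.
case/orP=> [h|/andP[/eqP-> /orP[/eqP->//|h]]]; apply: mono; apply: ex => //.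
  by rewrite h.
by rewrite h eqxx orbT.
Qed.

Lemma main_progP (st := den main_prog (input G s t z T lam)) :
  exists l, [/\ outputs st l, good s t z T lam l
    & forall e f, in_z z e -> out_z z f -> exhausted s t z T lam l e f].
Proof.
set st0 := input G s t z T lam in st *.
have nthE (I : finType) (A : Type) (x0 : A) (F : I -> A) (a : I) :
    nth x0 [seq F i | i <- enum I] (code a) = F a.
  rewrite (nth_map a); last by rewrite -cardE code_lt.
  by rewrite /code nth_enum_rank.
have S0 : static st0.
  by split=> [|||e|e|v|] //=; rewrite ?nthE.
rewrite {}/st /main_prog den_seq; set p2 := PFor 8 1 _; set p1 := PFor 8 1 _.
(* The first loop builds the capacities of the empty list, which is good by the cut condition; no
   pair counts as treated yet. *)
have ok1 : state_ok (fun _ _ => false) (den p1 st0).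
  pose Inv k st1 := [/\ static st1, forall e, rmem st1 1 (code e) 0%N = weight e,
    forall a b : V, rmem st1 3 (code a) (code b) =
      \sum_(x : edge G | (code x < k)%N) weight x * adj R (tail x) (head x) a b
    & outputs st1 ([::] : seq (edge G * edge G * R))].
  suff: Inv #|edge G| (den p1 st0).
    case=> S w3 c3 o3; exists [::]; split=> //.
    - split=> // [e|a b]; first by rewrite w3 /rest big_nil subr0.
      by rewrite c3; apply: eq_bigl => x; rewrite code_lt.
    split=> // [e|U /andP[h1 h2]]; first by rewrite /rest big_nil subr0.
    exact: cut_ge.
  rewrite -(st_m S0); apply: den_for => //.
    split=> // [|e|a b].
    - apply: static_eq S0 => // a i a4.
      by rewrite /= /write; case: eqP => // h; rewrite h in a4.
    - by rewrite /= nthE.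
    (* Real array 3 is not part of the input, so it starts with the default value 0. *)
    - by rewrite big_pred0 //= /load /=; case: (code b) => //; rewrite nth_nil.
  rewrite (st_m S0) => k st1 /codeP[e <-] e8 [S w3 c3 o3].
  set st2 := den _ st1.
  have N2 a i j : nmem st2 a i j = nmem st1 a i j by rewrite /st2 den_nframe.
  split.
  - apply: static_eq S => [a i a4|]; last by rewrite /= den_rframe.
    by rewrite /= /write; case: eqP => [h|_]; [rewrite h in a4|rewrite !N2].
  - by move=> x; rewrite /= den_rframe.
  - move=> a b; rewrite /= (@add_edge_progP _ _ _ _ (tail e) (head e)) //=.
    + rewrite c3 e8 w3 [in RHS](bigD1 e) //= addrC; congr (_ + _).
      by apply: eq_bigl => x; rewrite ltnS ltn_neqAle code_eq andbC.
    + by rewrite e8 (st_tail S).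
    + by rewrite e8 (st_head S).
  apply: outputs_eq o3 => [a i ha|i]; last by rewrite /= den_rframe.
  by rewrite /= /write; case: eqP => [h|_]; [rewrite h in ha|rewrite !N2].
have S1 : static (den p1 st0) by case: ok1 => l [].
suff [l [S [_ _ o] gl ex]] : state_ok (fun e _ => (code e < #|edge G|)%N)
    (den p2 (den p1 st0)).
  by exists l; split=> // e f h1 h2; apply: ex => //; apply: code_lt.
pose Inv k st1 := state_ok (fun e _ => (code e < k)%N) st1.
rewrite -(st_m S1); apply: (@den_for _ 8 1 _ _ Inv) => //.
  by apply: state_ok_eq ok1 => // a i a7; rewrite /= /write; case: eqP => // h;
    rewrite h in a7.
rewrite (st_m S1) => k st1 /codeP[e <-] e8 ok.
set st2 := den _ st1; apply: (@state_ok_eq _ st2) => //.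
  by move=> a i a7; rewrite /= /write; case: eqP => // h; rewrite h in a7.
have [l [S tr gl ex]] := ok.
rewrite /st2 den_if /= e8 (st_tail S) (st_head S) (st_z S) -!eqn_leq !code_eq.
rewrite andbC -/(in_z z e); case: ifP => ein.
  have [l' [S' tr' gl' ex']] := inner_progP ein e8 ok.
  exists l'; split=> // e' f' h1 h2; rewrite ltnS leq_eqVlt code_eq orbC.
  exact: ex'.
exists l; split=> // e' f' h1 h2; rewrite ltnS leq_eqVlt code_eq.
have /negPf-> : e' != e by apply: contraTneq h1 => ->; rewrite ein.
exact: ex.
Qed.

End Correctness.

(** * Conservation at [z], and joining running time with correctness *)

Lemma unit_flow_balanced (R : realFieldType) (V : finType) (G : wdigraph R V) s t z :
  unit_flow G s t -> z != s -> z != t ->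
  total (delta_in G [set z]) = total (delta_out G [set z]).
Proof.
move=> /(_ z) fl /negPf zs /negPf zt; move: fl; rewrite zs zt => /eqP.
by rewrite subr_eq0 => /eqP.
Qed.

Theorem theorem5p4 :
  exists (P : cmd) (c d : nat),
  forall (R : realFieldType) (V : finType) (G : wdigraph R V)
         (s t z : V) (T : {set V}) (lambda : R),
    (forall e : edge G, 0 <= weight e) ->
    unit_flow G s t ->
    T \subset ~: [set s; t] ->
    z \notin [set s; t] :|: T ->
    0 < lambda <= 2 ->
    cut_condition G s t T lambda ->
    exists (n : nat) (st : state R) (l : seq (edge G * edge G * R)),
      [/\ exec P (input G s t z T lambda) n st,
          (n <= c * (#|V| + #|edge G|) ^ d)%N
        & outputs st l] /\
      [/\ (forall e f gamma, (e, f, gamma) \in l ->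
             [/\ e \in delta_in G [set z], f \in delta_out G [set z]
               & 0 < gamma]),
          cut_condition (split_off_all l) s t T lambda
        & forall e, e \in delta (split_off_all l) [set z] -> weight e = 0].
Proof.
exists (compile main_prog), (tcoef main_prog), (tdeg main_prog).
move=> R V G s t z T lam w0 fl _ zn /andP[lam0 _] cut.
have bal : total (delta_in G [set z]) = total (delta_out G [set z]).
  by apply: unit_flow_balanced fl _ _; apply: contraNneq zn => ->; rewrite !inE eqxx ?orbT.
have [l [o gl exh]] := main_progP w0 zn (ltW lam0) cut.
have [||n ex nle] := @exec_den R main_prog (input G s t z T lam); first by [].
  by rewrite /= addn_gt0; apply/orP; left; apply/card_gt0P; exists z.
exists n, (den main_prog (input G s t z T lam)), l; split=> //.
have [l_at _ cl] := gl; split.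
- by move=> e f g /l_at[]; rewrite in_zE out_zE.
- by move=> U h1 h2; apply: cl; rewrite /required h1.
exact: (exhausted_isolated bal zn gl exh).
Qed.
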